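(* Let $\sigma\colon(\mathcal M,L)\to(\mathcal B,\tilde L)$ be a pseudo-Finsler submersion with Cartan tensors $C$ and $\tilde C$. For each horizontal $v\in T_p\mathcal M$, $g_v$-horizontal $x,y\in T_p\mathcal M$ and arbitrary $e\in T_p\mathcal M$, writing $\tilde v=d\sigma(v)$, $\tilde x=d\sigma(x)$, etc., $$C_v(x,y,e)=\tilde C_{\tilde v}(\tilde x,\tilde y,\tilde e)-\tfrac12 g_v(\mathrm{II}^{\mathcal H}_v(x,y),e),$$ where $\mathrm{II}^{\mathcal H}_v$ is the second fundamental form at $v$ of the set $\mathcal H_p$ of horizontal vectors at $p$ as a submanifold of $(T_p\mathcal M,g_v)$.
   Context: A pseudo-Finsler metric on $\mathcal M$ is a smooth $L\colon\mathcal A\to\mathbb R$, $\mathcal A\subset T\mathcal M\setminus\mathbf 0$ open and invariant under positive scalar multiplication, with $L(\lambda v)=\lambda^2L(v)$ for $\lambda>0$ and with non-degenerate fundamental tensor $g_v(e,h)=\frac12\frac{\partial^2}{\partial s\partial t}L(v+se+th)|_{s=t=0}$ for every $v\in\mathcal A$ (elements of $\mathcal A$ are called admissible). Its Cartan tensor is $C_v(b,e,h)=\frac14\frac{\partial^3}{\partial r\partial s\partial t}L(v+rb+se+th)|_{r=s=t=0}$. Let $\sigma\colon\mathcal M\to\mathcal B$ be a surjective map with surjective differential; vertical vectors at $p$ are the elements of $\mathcal V_p=\ker d\sigma_p$. An admissible $v\in T_p\mathcal M$ is horizontal if $g_v(v,w)=0$ for all $w\in\mathcal V_p$; a vector $x\in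 T_p\mathcal M$ is $g_v$-horizontal if it is $g_v$-orthogonal to $\mathcal V_p$. $\sigma\colon(\mathcal M,L)\to(\mathcal B,\tilde L)$ is a pseudo-Finsler submersion if (i) the restriction of $L$ to the tangent spaces of the fibers is a pseudo-Finsler metric on each fiber, and (ii) $L(v)=\tilde L(d\sigma(v))$ for every horizontal $v$ (in particular $d\sigma(v)$ is admissible for $\tilde L$). For every horizontal $v$ the vertical space $\mathcal V_p$ is $g_v$-non-degenerate. $\mathcal H_p$ is a smooth submanifold of the vector space $T_p\mathcal M$, whose tangent space at $v\in\mathcal H_p$ is the space of $g_v$-horizontal vectors. $T_p\mathcal M$ is regarded as a flat pseudo-Riemannian manifold with the constant metric $g_v$; $\mathrm{II}^{\mathcal H}_v(x,y)$ is the component in $\mathcal V_p$ (the $g_v$-normal space of $\mathcal H_p$ at $v$) of the flat derivative at $v$, in the direction $x$, of a vector field tangent to $\mathcal H_p$ extending $y$. *)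

(* Defs.v *)
From HB Require Import structures.
From mathcomp Require Export all_boot all_order all_algebra.
From mathcomp Require Export all_classical all_reals all_analysis.
Set Implicit Arguments.
Unset Strict Implicit.
Unset Printing Implicit Defensive.
Export numFieldNormedType.Exports.
Import Order.TTheory GRing.Theory Num.Theory.
Local Open Scope classical_set_scope.
Local Open Scope ring_scope.

(* Meant for [U] open and [V] finite-dimensional, where asking for all the
   directional derivatives is the same as asking for the Frechet derivative. *)
Fixpoint Ck_on (R : realType) (V W : normedModType R) (k : nat)
    (U : set V) (f : V -> W) : Prop :=
  if k is k'.+1 then
    (forall x, U x -> differentiable f x) /\
    (forall v, Ck_on k' U (fun x => 'D_v f x))
  else forall x, U x -> {for x, continuous f}.

Definition smooth_on (R : realType) (V W : normedModType R)
    (U : set V) (f : V -> W) : Prop := forall k, Ck_on k U f.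

(* [cmap] and [cinv] are total functions; they are only meaningful on [cdom]
   and on its image, respectively. *)
Record chart (R : realType) (n : nat) (M : Type) := Chart {
  cdom : set M ;
  cmap : M -> 'rV[R]_n ;
  cinv : 'rV[R]_n -> M }.

Definition cimg (R : realType) n M (c : chart R n M) : set 'rV[R]_n :=
  cmap c @` cdom c.

(* Besides an atlas we record a preferred chart around each point.  The tangent
   space at [p] is 'rV[R]_n, a vector being represented by its components in the
   preferred chart at [p]; changing [mchart_at] changes everything below by
   linear isomorphisms of the tangent spaces only. *)
Record manifold (R : realType) (n : nat) := Manifold {
  msort :> topologicalType ;
  matlas : set (chart R n msort) ;
  mchart_at : msort -> chart R n msort ;
  _ : hausdorff_space msort ;
  _ : @second_countable msort ;
  _ : forall p, matlas (mchart_at p) /\ cdom (mchart_at p) p ;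
  _ : forall c, matlas c ->
      [/\ open (cdom c), open (cimg c),
          forall p, cdom c p -> cinv c (cmap c p) = p,
          {within cdom c, continuous (cmap c)} &
          {within cimg c, continuous (cinv c)}] ;
  _ : forall c d, matlas c -> matlas d ->
      smooth_on (cmap c @` (cdom c `&` cdom d)) (cmap d \o cinv c) }.

(* The tangent vector at [cinv c z.1] whose components in the chart [c] are
   [z.2]; together with [cinv c] this is the chart of the tangent bundle
   induced by [c]. *)
Definition tvec (R : realType) n (M : manifold R n) (c : chart R n M)
    (z : 'rV[R]_n * 'rV[R]_n) : 'rV[R]_n :=
  'D_(z.2) (cmap (mchart_at (cinv c z.1)) \o cinv c) z.1.

Definition smooth_map (R : realType) m n (M : manifold R m) (N : manifold R n)
    (s : M -> N) : Prop :=
  continuous s /\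
  forall c d, matlas c -> matlas d ->
    smooth_on (cmap c @` (cdom c `&` s @^-1` cdom d)) (cmap d \o s \o cinv c).

Definition differential (R : realType) m n (M : manifold R m) (N : manifold R n)
    (s : M -> N) (p : M) (v : 'rV[R]_m) : 'rV[R]_n :=
  'D_v (cmap (mchart_at (s p)) \o s \o cinv (mchart_at p))
       (cmap (mchart_at p) p).

(* Here [L] is the restriction of a pseudo-Finsler metric to one tangent
   space [V]. *)
Definition fundamental_tensor (R : realType) (V : normedModType R)
    (L : V -> R) (v e h : V) : R :=
  2^-1 * derive1 (fun s : R => derive1 (fun t : R =>
    L (v + s *: e + t *: h)) 0) 0.

Definition cartan_tensor (R : realType) (V : normedModType R)
    (L : V -> R) (v b e h : V) : R :=
  4^-1 * derive1 (fun r : R => derive1 (fun s : R => derive1 (fun t : R =>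
    L (v + r *: b + s *: e + t *: h)) 0) 0) 0.

Definition nondegenerate_on (R : realType) (V : normedModType R)
    (g : V -> V -> R) (S : set V) : Prop :=
  forall e, S e -> (forall h, S h -> g e h = 0) -> e = 0.

(* [admissible p] is the part of the domain of the metric in the tangent space
   at [p]; the value of [pfL] off that domain is irrelevant. *)
Record pseudo_finsler (R : realType) n (M : manifold R n) := PseudoFinsler {
  admissible : M -> set 'rV[R]_n ;
  pfL :> M -> 'rV[R]_n -> R ;
  _ : forall p, ~ admissible p 0 ;
  _ : forall p v (l : R), 0 < l -> admissible p v -> admissible p (l *: v) ;
  _ : forall c, matlas c ->
      open [set z | cimg c z.1 /\ admissible (cinv c z.1) (tvec c z)] ;
  _ : forall c, matlas c ->
      smooth_on [set z | cimg c z.1 /\ admissible (cinv c z.1) (tvec c z)]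
                (fun z => pfL (cinv c z.1) (tvec c z)) ;
  _ : forall p v (l : R), 0 < l -> admissible p v ->
      pfL p (l *: v) = l ^+ 2 * pfL p v ;
  _ : forall p v, admissible p v ->
      nondegenerate_on (fundamental_tensor (pfL p) v) setT }.

Section Submersion.
Variables (R : realType) (m n : nat) (M : manifold R m) (B : manifold R n).
Variables (L : pseudo_finsler M) (Lt : pseudo_finsler B) (s : M -> B).

Definition vertical (p : M) : set 'rV[R]_m :=
  [set w | differential s p w = 0].

(* the g_v-horizontal vectors at [p] *)
Definition g_horizontal (p : M) (v : 'rV[R]_m) : set 'rV[R]_m :=
  [set x | forall w, vertical p w -> fundamental_tensor (L p) v x w = 0].

Definition horizontal (p : M) : set 'rV[R]_m :=
  [set v | admissible L p v /\ g_horizontal p v v].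

(* The tangent space at [p] of the fiber through [p] is [vertical p].  The
   restriction of [L] to the tangent bundle of a fiber inherits all the
   properties of a pseudo-Finsler metric except the non-degeneracy of its
   fundamental tensor, which is therefore the content of the fourth clause. *)
Definition pseudo_finsler_submersion : Prop :=
  [/\ smooth_map s,
      (forall b, exists p, s p = b),
      (forall p u, exists v, differential s p v = u),
      (forall p v, admissible L p v -> vertical p v ->
         nondegenerate_on (fundamental_tensor (L p) v) (vertical p)) &
      (forall p v, horizontal p v ->
         admissible Lt (s p) (differential s p v) /\
         L p v = Lt (s p) (differential s p v))].

End Submersion.

Section SecondFundamentalForm.
Variables (R : realType) (V : normedModType R) (H : set V).

(* Velocities at [u] of the smooth curves lying in [H]: for [H] a submanifold,
   the tangent space of [H] at [u]. *)
Definition tangent_space (u : V) : set V :=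
  [set x | exists2 a : R, 0 < a & exists c : R -> V,
     [/\ smooth_on [set t : R | `|t| < a] c,
         forall t : R, `|t| < a -> H (c t),
         c 0 = u & 'D_1 c 0 = x]].

Definition normal_space (g : V -> V -> R) (u : V) : set V :=
  [set w | forall x, tangent_space u x -> g w x = 0].

(* [w] is the component normal to [H] of the derivative at [v] in the direction
   [x] of a vector field [Y] tangent to [H] with [Y v = y]; [Y] is given by a
   smooth extension to a neighbourhood of [v] in the ambient space. *)
Definition is_second_fundamental_form (g : V -> V -> R) (v x y w : V) : Prop :=
  exists (U : set V) (Y : V -> V),
    [/\ open U /\ U v, smooth_on U Y,
        forall u, U u -> H u -> tangent_space u (Y u),
        Y v = y &
        normal_space g v w /\ tangent_space v ('D_x Y v - w)].

(* The second fundamental form at [v] of [H] in [V] with the flat metric [g];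
   the default value 0 is used only if no [w] as above exists. *)
Definition second_fundamental_form (g : V -> V -> R) (v x y : V) : V :=
  xget 0 (is_second_fundamental_form g v x y).

End SecondFundamentalForm.

(* Main.v *)
(* On the horizontal vectors u one has D_z F (u) = D_{Tz} Ft (Tu) for every z,
   where F and Ft are the restrictions of L and Lt to the tangent spaces at p
   and at sigma p, and T is the differential of sigma: for vertical z both sides
   vanish (horizontality of u and the Euler identity), and for g_u-horizontal z
   it is the derivative of F = Ft o T along the submanifold H of horizontal
   vectors.  Differentiating along H gives D_x D_e F = D_{Tx} D_{Te} Ft at u for
   x tangent to H, and differentiating D_Y D_e F = D_{TY} D_{Te} Ft once more in
   the direction x, with Y a tangent field extending y, produces the third
   derivatives and the extra term D_{D_x Y} D_e F - D_{T(D_x Y)} D_{Te} Ft.  By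
   the previous identity only the vertical part II(x, y) of D_x Y contributes
   to it.

   That H has enough tangent vectors and tangent fields follows from the inverse
   function theorem for u |-> u - P u + #(dF_u), where P is the g_v-orthogonal
   projection onto the vertical space and # turns the restriction of a covector
   to the vertical space into a vertical vector: this map has differential 1 at
   v, and it straightens H. *)
From HB Require Import structures.
Require Import Defs.
From mathcomp Require Import ring lra.
Set Implicit Arguments.
Unset Strict Implicit.
Unset Printing Implicit Defensive.
Import Order.TTheory GRing.Theory Num.Theory.
Local Open Scope classical_set_scope.
Local Open Scope ring_scope.

(** * Smooth functions *)

Section Derive.
Context {R : realType} {V W : normedModType R}.

(** The first-order expansion at [x] sees only values near [x], so [g] satisfies the expansion of
    [f]; uniqueness then identifies the two differentials. *)
Lemma near_eq_differentiable (f g : V -> W) (x : V) :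
  (\near x, f x = g x) -> differentiable f x -> differentiable g x.
Proof.
move=> fg df.
have fx : f x = g x by exact: (nbhs_singleton fg).
apply/diff_locallyP.
have fg0 : \forall h \near 0, f (h + x) = g (h + x).
  by move: fg; rewrite (near_shift 0 x) subr0; exact.
have E : g \o shift x = cst (g x) + 'd f x +o_ (0 : V) id.
  apply/eqaddoP => _/posnumP[e].
  have /eqaddoP/(_ e%:num) := diff_locally df.
  move=> /(_ [gt0 of e%:num]); apply: filterS2 fg0.
  by move=> h /= fgh; rewrite !fctE /= fgh fx.
have c : continuous ('d f x) by exact: diff_continuous.
by rewrite (diff_unique c E).
Qed.

Lemma differentiable_id (x : V) : differentiable id x.
Proof. exact: ex_diff. Qed.

Lemma derive_comp (U : normedModType R) (g : U -> V) (f : V -> W) (x w : U) :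
  differentiable g x -> differentiable f (g x) ->
  'D_w (f \o g) x = 'D_('D_w g x) f (g x).
Proof.
move=> dg df; rewrite !deriveE //; last exact: differentiable_comp.
by rewrite diff_comp.
Qed.

Lemma derive_lin (l : {linear V -> W}) (x v : V) : continuous l -> 'D_v l x = l v.
Proof. by move=> cl; rewrite deriveE ?diff_lin //; exact: linear_differentiable. Qed.

End Derive.

(** * Closure properties of C^k and smooth functions *)

Section Ck.
Context {R : realType} {V : normedModType R}.
Implicit Types (U : set V) (k : nat).

(** Openness of [U] turns equality on [U] into equality near each point of [U], which passes to
    derivatives. *)
Lemma Ck_on_eq (W : normedModType R) k U (f g : V -> W) : open U ->
  (forall x, U x -> f x = g x) -> Ck_on k U f -> Ck_on k U g.
Proof.
move=> oU; elim: k f g => [|k IH] f g fg /=.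
  move=> cf x Ux; rewrite /prop_for /continuous_at -fg //.
  apply: cvg_trans (cf x Ux); apply: near_eq_cvg.
  by near=> y; apply: fg; near: y; exact: open_nbhs_nbhs.
have nfg x : U x -> \near x, f x = g x.
  by move=> Ux; near=> y; apply: fg; near: y; exact: open_nbhs_nbhs.
case=> df Df; split=> [x Ux|v].
  exact: near_eq_differentiable (nfg _ Ux) (df _ Ux).
apply: (IH ('D_v f)) => // x Ux; apply: near_eq_derive; exact: nfg.
Unshelve. all: by end_near. Qed.

Lemma Ck_on_pred (W : normedModType R) k U (f : V -> W) :
  Ck_on k.+1 U f -> Ck_on k U f.
Proof.
elim: k f => [|k IH] f /= [df Df].
  by move=> x Ux; exact: differentiable_continuous (df x Ux).
by split=> // v; exact: IH (Df v).
Qed.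

Lemma Ck_on_cst (W : normedModType R) k U (w : W) : Ck_on k U (fun=> w).
Proof.
elim: k w => [|k IH] w /=; first by move=> x _; exact: cst_continuous.
split=> [x _|v]; first exact: differentiable_cst.
have -> : 'D_v (fun=> w) = fun _ : V => (0 : W) by apply/funext => x; exact: derive_cst.
exact: IH.
Qed.

Lemma Ck_onD (W : normedModType R) k U (f g : V -> W) : open U ->
  Ck_on k U f -> Ck_on k U g -> Ck_on k U (fun x => f x + g x).
Proof.
move=> oU; elim: k f g => [|k IH] f g /=.
  by move=> cf cg x Ux; apply: continuousD; [exact: cf|exact: cg].
move=> [df Df] [dg Dg]; split=> [x Ux|v].
  by apply: (differentiableD (df x Ux) (dg x Ux)).
apply: (Ck_on_eq oU _ (IH _ _ (Df v) (Dg v))) => x Ux.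
by rewrite -deriveD //; apply: diff_derivable; [exact: df|exact: dg].
Qed.

Lemma Ck_onM k U (f g : V -> R) : open U ->
  Ck_on k U f -> Ck_on k U g -> Ck_on k U (fun x => f x * g x).
Proof.
move=> oU; elim: k f g => [|k IH] f g.
  by move=> cf cg x Ux; apply: continuousM; [exact: cf|exact: cg].
move=> Cf Cg; have /= [df Df] := Cf; have /= [dg Dg] := Cg; split=> [x Ux|v].
  by apply: (differentiableM (df x Ux) (dg x Ux)).
apply: (Ck_on_eq oU _ (Ck_onD oU (IH _ _ (Ck_on_pred Cf) (Dg v))
  (IH _ _ (Ck_on_pred Cg) (Df v)))) => x Ux.
by apply/esym; apply: deriveM; apply: diff_derivable; [exact: df|exact: dg].
Qed.

Lemma Ck_onV k U (f : V -> R) : open U -> (forall x, U x -> f x != 0) ->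
  Ck_on k U f -> Ck_on k U (fun x => (f x)^-1).
Proof.
move=> oU f0; elim: k => [|k IH].
  by move=> cf x Ux; apply: continuousV; [exact: f0|exact: cf].
move=> Cf; have /= [df Df] := Cf; split=> [x Ux|v].
  by apply: differentiableV; [exact: df|exact: f0].
(* By induction 1/f is C^k, so the derivative -(1/f)^2 D_v f is a product of C^k functions. *)
have C1 := IH (Ck_on_pred Cf).
apply: (Ck_on_eq oU _ (Ck_onM oU (Ck_on_cst k U (-1 : R))
  (Ck_onM oU (Ck_onM oU C1 C1) (Df v)))) => x Ux.
rewrite deriveV ?f0 //; last by apply: diff_derivable; exact: df.
by rewrite -[_ *: _]/(_ * _) expr2 invfM mulN1r mulNr.
Qed.

Lemma Ck_onZl (W : normedModType R) k U (f : V -> R) (w : W) : open U ->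
  Ck_on k U f -> Ck_on k U (fun x => f x *: w).
Proof.
move=> oU; elim: k f => [|k IH] f /=.
  by move=> cf x Ux; apply: cvgZr_tmp; exact: cf.
move=> [df Df]; split=> [x Ux|v]; first by apply: differentiableZl; exact: df.
apply: (Ck_on_eq oU _ (IH _ (Df v))) => x Ux.
have dfx := df x Ux; rewrite !deriveE ?diffZl //; exact: differentiableZl.
Qed.

Lemma Ck_on_lin (W : normedModType R) k U (l : {linear V -> W}) :
  continuous l -> Ck_on k U l.
Proof.
move=> cl; case: k => [x _|k /=]; first exact: cl.
split=> [x _|v]; first exact: linear_differentiable.
have -> : 'D_v l = fun=> l v by apply/funext => x; exact: derive_lin.
exact: Ck_on_cst.
Qed.

Lemma smooth_on_derive (W : normedModType R) U (f : V -> W) v :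
  smooth_on U f -> smooth_on U ('D_v f).
Proof. by move=> sf k; exact: (sf k.+1).2. Qed.

Lemma smooth_on_differentiable (W : normedModType R) U (f : V -> W) x :
  smooth_on U f -> U x -> differentiable f x.
Proof. by move=> sf; have [+ _] := sf 1%N; exact. Qed.

Lemma smooth_on_continuous (W : normedModType R) U (f : V -> W) x :
  smooth_on U f -> U x -> {for x, continuous f}.
Proof. by move=> sf; exact: (sf 0%N). Qed.

Lemma smooth_on_sub (W : normedModType R) U U' (f : V -> W) :
  U' `<=` U -> smooth_on U f -> smooth_on U' f.
Proof.
move=> UU + k; elim: k f => [|k IH] f sf /=.
  by move=> x /UU; exact: smooth_on_continuous.
split=> [x /UU|v]; first exact: smooth_on_differentiable.
by apply: IH; exact: smooth_on_derive.
Qed.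

Lemma smooth_on_eq (W : normedModType R) U (f g : V -> W) : open U ->
  (forall x, U x -> f x = g x) -> smooth_on U f -> smooth_on U g.
Proof. by move=> oU fg sf k; exact: Ck_on_eq fg (sf k). Qed.

Lemma smooth_on_cst (W : normedModType R) U (w : W) : smooth_on U (fun=> w).
Proof. by move=> k; exact: Ck_on_cst. Qed.

Lemma smooth_onD (W : normedModType R) U (f g : V -> W) : open U ->
  smooth_on U f -> smooth_on U g -> smooth_on U (fun x => f x + g x).
Proof. by move=> oU sf sg k; exact: Ck_onD. Qed.

Lemma smooth_onM U (f g : V -> R) : open U ->
  smooth_on U f -> smooth_on U g -> smooth_on U (fun x => f x * g x).
Proof. by move=> oU sf sg k; exact: Ck_onM. Qed.

Lemma smooth_on_sum (W : normedModType R) U (I : Type) (r : seq I) (P : pred I)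
    (f : I -> V -> W) : open U -> (forall i, smooth_on U (f i)) ->
  smooth_on U (fun x => \sum_(i <- r | P i) f i x).
Proof.
move=> oU sf; elim: r => [|i r IH].
  by under eq_fun do rewrite big_nil; exact: smooth_on_cst.
under eq_fun do rewrite big_cons; case: (P i) => //; exact: smooth_onD.
Qed.

Lemma smooth_on_prod U (I : Type) (r : seq I) (P : pred I)
    (f : I -> V -> R) : open U -> (forall i, smooth_on U (f i)) ->
  smooth_on U (fun x => \prod_(i <- r | P i) f i x).
Proof.
move=> oU sf; elim: r => [|i r IH].
  by under eq_fun do rewrite big_nil; exact: smooth_on_cst.
under eq_fun do rewrite big_cons; case: (P i) => //; exact: smooth_onM.
Qed.

Lemma smooth_on_row m U (f : V -> 'rV[R]_m) : open U ->
  (forall j, smooth_on U (fun x => f x 0 j)) -> smooth_on U f.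
Proof.
move=> oU sf; have -> : f = fun x => \sum_j f x 0 j *: delta_mx 0 j.
  by apply/funext => x; exact: row_sum_delta.
by apply: smooth_on_sum => // j k; apply: Ck_onZl => //; exact: sf.
Qed.

Lemma smooth_on_det m U (N : V -> 'M[R]_m) : open U ->
  (forall i j, smooth_on U (fun x => N x i j)) -> smooth_on U (fun x => \det (N x)).
Proof.
move=> oU sN; apply: smooth_on_sum => // s; apply: smooth_onM => //.
  exact: smooth_on_cst.
by apply: smooth_on_prod.
Qed.

(** Cramer's rule: the entries of the inverse are cofactors divided by the determinant. *)
Lemma smooth_on_invmx m U (N : V -> 'M[R]_m) i j : open U ->
  (forall i j, smooth_on U (fun x => N x i j)) ->
  (forall x, U x -> N x \in unitmx) -> smooth_on U (fun x => invmx (N x) i j).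
Proof.
move=> oU sN uN.
apply: (smooth_on_eq (f := fun x => (\det (N x))^-1 * cofactor (N x) j i)) => //.
  by move=> x Ux; rewrite /invmx uN // !mxE.
apply: smooth_onM => //.
  move=> k; apply: Ck_onV => // [x /uN|]; first by rewrite unitmxE unitfE.
  exact: smooth_on_det.
apply: smooth_onM => //; first exact: smooth_on_cst.
apply: smooth_on_det => // i' j'.
by under eq_fun do rewrite !mxE; exact: sN.
Qed.

End Ck.

(** * Directional derivatives and the symmetry of second derivatives *)

Section Lines.
Context {R : realType} {V : normedModType R}.

(** Turns the iterated one-variable derivatives that define the tensors into iterated directional
    derivatives. *)
Lemma derive1_line (W : normedModType R) (f : V -> W) (u x : V) :
  derive1 (fun t : R => f (u + t *: x)) 0 = 'D_x f u.
Proof.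
rewrite /derive1 /derive.
(* Both sides are limits of difference quotients, which agree for every increment. *)
set g1 := fun h => h^-1 *: _; set g2 := fun h => h^-1 *: _.
suff -> : g1 = g2 by [].
apply/funext => h; rewrite /g1 /g2 /=.
by rewrite addr0 scale0r addr0 (addrC u).
Qed.

Lemma fundamental_tensorE (F : V -> R) (v e h : V) :
  fundamental_tensor F v e h = 2^-1 * 'D_e ('D_h F) v.
Proof.
have E (s : R) : derive1 (fun t : R => F (v + s *: e + t *: h)) 0 =
    'D_h F (v + s *: e) by exact: derive1_line.
by rewrite /fundamental_tensor (eq_fun E) (derive1_line ('D_h F)).
Qed.

Lemma cartan_tensorE (F : V -> R) (v b e h : V) :
  cartan_tensor F v b e h = 4^-1 * 'D_b ('D_e ('D_h F)) v.
Proof.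
have E (r : R) : derive1 (fun s : R => derive1 (fun t : R =>
    F (v + r *: b + s *: e + t *: h)) 0) 0 = 'D_e ('D_h F) (v + r *: b).
  have E (s : R) : derive1 (fun t : R => F (v + r *: b + s *: e + t *: h)) 0 =
      'D_h F (v + r *: b + s *: e) by exact: derive1_line.
  by rewrite (eq_fun E) (derive1_line ('D_h F)).
by rewrite /cartan_tensor (eq_fun E) (derive1_line ('D_e ('D_h F))).
Qed.

Lemma is_derive_line (W : normedModType R) (f : V -> W) (u x : V) (a : R) :
  differentiable f (u + a *: x) ->
  is_derive a (1 : R) (fun t : R => f (u + t *: x)) ('D_x f (u + a *: x)).
Proof.
move=> df; pose g (t : R) := u + t *: x.
have dg : differentiable g a.
  by apply: differentiableD; [exact: differentiable_cst|exact: differentiableZl].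
have Dg : 'D_1 g a = x.
  have dl : differentiable (fun t : R => t *: x) a by exact: differentiableZl.
  rewrite (deriveD (f := cst u)) ?derive_cst ?add0r.
  - rewrite deriveE // diffZl; last exact: differentiable_id.
    by rewrite (diff_val (f := id)) scale1r.
  - exact: derivable_cst.
  - exact: diff_derivable.
split; first by apply/diff_derivable/(differentiable_comp dg).
by have := derive_comp (1 : R^o) dg df; rewrite Dg.
Qed.

Lemma MVT_line (f : V -> R) (u x : V) (s : R) : 0 <= s ->
  (forall a, 0 <= a <= s -> differentiable f (u + a *: x)) ->
  exists2 a, 0 <= a <= s & f (u + s *: x) - f u = s * 'D_x f (u + a *: x).
Proof.
move=> s0 df; pose h (t : R) : R := f (u + t *: x).
have dh a : a \in `[0, s] -> is_derive a (1 : R) h ('D_x f (u + a *: x)).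
  by rewrite in_itv /= => ha; apply: is_derive_line; exact: df.
pose dh' (a : R) : R := 'D_x f (u + a *: x).
have drv : forall a, a \in `]0, s[%R -> is_derive a (1 : R) h (dh' a).
  move=> a; rewrite in_itv /= => /andP[a0 a1]; apply: dh.
  by rewrite in_itv /= !ltW.
have cont : {within `[0, s], continuous h}.
  by apply: derivable_within_continuous => a /dh [].
have [a] := MVT_segment s0 drv cont.
rewrite in_itv /= => ha; rewrite /h scale0r addr0 subr0 mulrC => ->.
by exists a.
Qed.

End Lines.

(** * Symmetry of second derivatives *)

Section NearEq.
Context {R : realType} {V : normedModType R}.

(** Distinct values at [u] would keep [G] and [H] apart near [u]. Two points [z] and [z'] are
    allowed because the mean value theorem yields the two mixed derivatives at different points. *)
Lemma continuous_near_eq (G H : V -> R) (u : V) :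
  {for u, continuous G} -> {for u, continuous H} ->
  (forall d, 0 < d -> exists z z', [/\ ball u d z, ball u d z' & G z = H z']) ->
  G u = H u.
Proof.
move=> cG cH near; apply/eqP/negPn/negP => neq.
pose e := `|G u - H u| / 2.
have e0 : 0 < e by rewrite divr_gt0 // normr_gt0 subr_eq0.
have /cvgrPdist_lt/(_ e e0)/nbhs_ballP[d1 /= d10 h1] := cG.
have /cvgrPdist_lt/(_ e e0)/nbhs_ballP[d2 /= d20 h2] := cH.
have [|z [z' [hz hz' E]]] := near (Num.min d1 d2); first by rewrite lt_min d10.
have {}h1 : `|G u - G z| < e by apply/h1/(le_ball _ hz); rewrite ge_min lexx.
have {}h2 : `|H u - H z'| < e.
  by apply/h2/(le_ball _ hz'); rewrite ge_min lexx orbT.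
have : `|G u - H u| < e + e.
  rewrite -(subrKA (G z)); apply: (le_lt_trans (ler_normD _ _)).
  by apply: ltrD => //; rewrite E distrC.
by rewrite -splitr ltxx.
Qed.

Lemma small_parallelogram (u x y : V) (d : R) : 0 < d ->
  exists2 s : R, 0 < s & forall a b, 0 <= a <= s -> 0 <= b <= s ->
    ball u d (u + a *: x + b *: y).
Proof.
(* The summand 1 keeps the denominator positive when [x] and [y] vanish; the factor 2 makes the
   final bound strict. *)
move=> d0; pose s := d / (2 * (1 + `|x| + `|y|)).
have B0 : 0 < 1 + `|x| + `|y| by rewrite -addrA ltr_wpDr ?addr_ge0.
have s0 : 0 < s by rewrite divr_gt0 // mulr_gt0.
exists s => // a b /andP[a0 a1] /andP[b0 b1].
rewrite -ball_normE /= distrC -(addrA u) (addrC u) addrK.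
apply: (le_lt_trans (ler_normD _ _)); rewrite !normrZ !ger0_norm //.
apply: (@le_lt_trans _ _ (s * (1 + `|x| + `|y|))).
  rewrite !mulrDr mulr1 -addrA ler_wpDl ?(ltW s0) //.
  by apply: lerD; apply: ler_wpM2r.
by rewrite /s invfM mulrA mulfVK ?gt_eqF // gtr_pMr // invf_lt1 // ltr1n.
Qed.

End NearEq.

Section Schwarz.
Context {R : realType} {V : normedModType R}.
Variables (A : set V) (F : V -> R).
Hypotheses (oA : open A) (sF : smooth_on A F).

(** The mean value theorem is applied twice: in the direction [x] to z |-> F(z + s y) - F(z), then
    in the direction [y] to D_x F. *)
Lemma double_difference (u x y : V) (s : R) : 0 <= s ->
  (forall a b, 0 <= a <= s -> 0 <= b <= s -> A (u + a *: x + b *: y)) ->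
  exists a b, [/\ 0 <= a <= s, 0 <= b <= s &
    F (u + s *: x + s *: y) - F (u + s *: x) - (F (u + s *: y) - F u) =
    s * (s * 'D_y ('D_x F) (u + a *: x + b *: y))].
Proof.
move=> s0 inA.
have s0s : 0 <= s <= s by apply/andP.
have z0s : 0 <= (0 : R) <= s by rewrite lexx s0.
have dF z : A z -> differentiable F z by exact: smooth_on_differentiable.
have inA0 a : 0 <= a <= s -> A (u + a *: x).
  by move=> ha; have := inA a 0 ha z0s; rewrite scale0r addr0.
pose f z := F (z + s *: y) - F z.
have dsh z w : differentiable (fun z : V => z + w) z.
  by apply: differentiableD; [exact: differentiable_id|exact: differentiable_cst].
have dFs a : 0 <= a <= s -> differentiable (fun z => F (z + s *: y)) (u + a *: x).
  move=> ha; apply: (differentiable_comp (f := fun z => z + s *: y)) => //.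
  by apply/dF/inA.
have df a : 0 <= a <= s -> differentiable f (u + a *: x).
  by move=> ha; apply: differentiableB; [exact: dFs|exact/dF/inA0].
have [a ha Ha] := MVT_line s0 df.
have Da : 'D_x f (u + a *: x) =
    'D_x F (u + a *: x + s *: y) - 'D_x F (u + a *: x).
  rewrite (deriveB (f := fun z => F (z + s *: y))); last 2 first.
  - by apply: diff_derivable; exact: dFs.
  - by apply: diff_derivable; exact/dF/inA0.
  congr (_ - _).
  rewrite /derive.
  set g1 := fun h => h^-1 *: _; set g2 := fun h => h^-1 *: _.
  suff -> : g1 = g2 by [].
  apply/funext => h; rewrite /g1 /g2 /=.
  by rewrite -(addrA (h *: x)).
have [b hb Hb] : exists2 b, 0 <= b <= s &
    'D_x F (u + a *: x + s *: y) - 'D_x F (u + a *: x) =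
    s * 'D_y ('D_x F) (u + a *: x + b *: y).
  apply: (MVT_line (f := 'D_x F) (u := u + a *: x)) => // b hb.
  exact: (smooth_on_differentiable (smooth_on_derive x sF) (inA _ _ ha hb)).
exists a, b; split => //; rewrite -Hb -Da -Ha /f.
by congr (_ - (F _ - _)).
Qed.

(** The double difference is symmetric in [x] and [y]. Hence arbitrarily close to [u] each mixed
    derivative takes a value that the other one takes too, and continuity gives equality at [u]. *)
Lemma derive_schwarz (u x y : V) : A u -> 'D_x ('D_y F) u = 'D_y ('D_x F) u.
Proof.
move=> Au.
have cont w z : {for u, continuous ('D_w ('D_z F))}.
  by apply: (smooth_on_continuous _ Au); do 2 apply: smooth_on_derive.
apply: (@continuous_near_eq R V ('D_x ('D_y F)) ('D_y ('D_x F)) u) => // d d0.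
have : nbhs u (A `&` ball u d).
  by apply: filterI; [exact: open_nbhs_nbhs|exact: nbhsx_ballx].
move=> /nbhs_ballP[d' /= d'0 hd].
have [s s0 near] := small_parallelogram u x y d'0.
have [a1 [b1 [ha hb E]]] := double_difference (ltW s0) (fun c e hc he =>
  (hd _ (near c e hc he)).1).
have near' a b : 0 <= a <= s -> 0 <= b <= s -> ball u d' (u + a *: y + b *: x).
  by move=> h1 h2; rewrite addrAC; exact: near.
have [a2 [b2 [ha' hb' E']]] := double_difference (ltW s0) (fun c e hc he =>
  (hd _ (near' c e hc he)).1).
exists (u + a2 *: y + b2 *: x), (u + a1 *: x + b1 *: y); split.
- by have [] := hd _ (near' _ _ ha' hb').
- by have [] := hd _ (near _ _ ha hb).
have sn0 : s != 0 by rewrite gt_eqF.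
have D : F (u + s *: y + s *: x) - F (u + s *: y) - (F (u + s *: x) - F u) =
    F (u + s *: x + s *: y) - F (u + s *: x) - (F (u + s *: y) - F u).
  by rewrite (addrAC u (s *: y)) !opprB addrACA [RHS]addrACA; congr (_ + _); rewrite addrC.
exact: (mulfI sn0 (mulfI sn0 (etrans (esym E') (etrans D E)))).
Qed.

End Schwarz.

(** * Restriction of functions on a product to a slice *)

Section Slice.
Context {R : realType} {V W X : normedModType R}.

(** The derivative of the restriction along [v] is the restriction of the derivative along [(0, v)],
    so the induction goes through. *)
Lemma Ck_on_slice k (O : set (V * W)) (f : V * W -> X) (q : V) :
  Ck_on k O f -> Ck_on k [set z | O (q, z)] (fun z => f (q, z)).
Proof.
have dq z : differentiable (fun z : W => (q, z)) z.
  by apply: differentiable_pair; [exact: differentiable_cst|exact: differentiable_id].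
elim: k f => [|k IH] f /=.
  move=> cf z Oz; apply: (continuous_comp (f := fun z : W => (q, z))).
    exact: differentiable_continuous.
  exact: cf.
move=> [df Df]; split=> [z Oz|v].
  by apply: (differentiable_comp (f := fun z : W => (q, z))) => //; exact: df.
rewrite (_ : 'D_v _ = fun z => 'D_(0, v) f (q, z)); first exact: (IH _ (Df (0, v))).
apply/funext => z; rewrite /derive.
set g1 := fun h => h^-1 *: _; set g2 := fun h => h^-1 *: _.
suff -> : g1 = g2 by [].
apply/funext => h; rewrite /g1 /g2 /=.
congr (_ *: (f _ - _)).
by rewrite (_ : (q, _) = (h *: 0 + q, h *: v + z)) // scaler0 add0r.
Qed.

Lemma open_slice (O : set (V * W)) (q : V) : open O -> open [set z | O (q, z)].
Proof.
move=> oO; have -> : [set z | O (q, z)] = (fun z : W => (q, z)) @^-1` O by [].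
apply: open_comp => // z _; apply: cvg_pair; [exact: cvg_cst|exact: cvg_id].
Qed.

End Slice.

(** * Maps of row vectors *)

(** Lets the normed space of matrices be recognised as complete, as the Banach fixed-point theorem
    requires. *)
HB.instance Definition _ (R : realType) m n :=
  Complete.copy 'M[R]_(m, n) 'M[R]_(m, n).

Section RowVectors.
Context {R : realType} {m : nat}.
Implicit Types (u w : 'rV[R]_m).

Lemma norm_row_le (w : 'rV[R]_m) (r : R) : 0 <= r ->
  (`|w| <= r) <-> (forall j, `|w 0 j| <= r).
Proof.
move=> r0; rewrite /Num.norm /= mx_normrE; split=> [h j|h].
  by apply: le_trans h; apply: (le_bigmax _ (fun i => `|w i.1 i.2|) (0, j)).
by apply: bigmax_le => // -[i j] _ /=; rewrite (ord1 i); exact: h.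
Qed.

Lemma ler_norm_coord (w : 'rV[R]_m) j : `|w 0 j| <= `|w|.
Proof. by move: j; apply/norm_row_le. Qed.

Lemma differentiable_row n (V : normedModType R) (f : V -> 'rV[R]_n) (x : V) :
  (forall j, differentiable (fun z => f z 0 j : R) x) -> differentiable f x.
Proof.
move=> df; have -> : f = \sum_j (fun z => f z 0 j *: delta_mx 0 j).
  by apply/funext => z; rewrite [LHS]row_sum_delta fct_sumE.
by apply: differentiable_sum => j; apply: differentiableZl.
Qed.

Lemma linear_row_differentiable (W : normedModType R)
    (l : {linear 'rV[R]_m -> W}) u : differentiable l u.
Proof.
have -> : (l : _ -> _) = \sum_j (fun z : 'rV[R]_m => z 0 j *: l (delta_mx 0 j)).
  apply/funext => z; rewrite [in LHS](row_sum_delta z) linear_sum fct_sumE.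
  by apply: eq_bigr => j _; rewrite linearZ.
apply: differentiable_sum => j; apply: differentiableZl.
exact: differentiable_coord.
Qed.

Lemma linear_row_continuous (W : normedModType R)
    (l : {linear 'rV[R]_m -> W}) : continuous l.
Proof. by move=> u; exact/differentiable_continuous/linear_row_differentiable. Qed.

Lemma coord_linear j :
  exists l : {linear 'rV[R]_m -> R}, (fun z : 'rV[R]_m => z 0 j : R) = l.
Proof.
have lin : linear (fun z : 'rV[R]_m => z 0 j : R) by move=> ? ? ?; rewrite !mxE.
pose lM := GRing.isLinear.Build _ _ _ _ _ lin.
pose l : {linear 'rV[R]_m -> R} := HB.pack (fun z : 'rV[R]_m => z 0 j : R) lM.
by exists l.
Qed.

Lemma smooth_on_coord (U : set 'rV[R]_m) j : smooth_on U (fun z : 'rV[R]_m => z 0 j : R).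
Proof.
have [l ->] := coord_linear j.
by move=> k; exact: (Ck_on_lin k U (linear_row_continuous (l := l))).
Qed.

Lemma derive_coord j u w : 'D_w (fun z : 'rV[R]_m => z 0 j : R) u = w 0 j.
Proof.
have [l E] := coord_linear j; have Ew : w 0 j = l w := congr1 (@^~ w) E.
rewrite E Ew.
exact: (derive_lin u w (linear_row_continuous (l := l))).
Qed.

Lemma derive_coord_sum (W : normedModType R) (f : 'rV[R]_m -> W) u w :
  differentiable f u ->
  'D_w f u = \sum_i w 0 i *: 'D_(delta_mx 0 i) f u.
Proof.
move=> df; rewrite deriveE // [in LHS](row_sum_delta w) linear_sum.
by apply: eq_bigr => j _; rewrite linearZ deriveE.
Qed.

(** The transpose of the usual Jacobian matrix: vectors are rows, so the differential acts by
    multiplication on the right. *)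
Definition jacobi (l : nat) (f : 'rV[R]_m -> 'rV[R]_l) (u : 'rV[R]_m) : 'M[R]_(m, l) :=
  \matrix_(i, j) 'D_(delta_mx 0 i) (fun z => f z 0 j : R) u.

Lemma derive_coord_jacobi l (f : 'rV[R]_m -> 'rV[R]_l) u w j :
  differentiable (fun z => f z 0 j : R) u ->
  'D_w (fun z => f z 0 j : R) u = (w *m jacobi f u) 0 j.
Proof.
by move=> df; rewrite derive_coord_sum // mxE; apply: eq_bigr => i _; rewrite !mxE.
Qed.

Lemma derive_jacobi l (f : 'rV[R]_m -> 'rV[R]_l) u w :
  (forall j, differentiable (fun z => f z 0 j : R) u) ->
  'D_w f u = w *m jacobi f u.
Proof.
move=> df; rewrite derive_mx; last by apply: diff_derivable; exact: differentiable_row.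
by apply/rowP => j; rewrite mxE -derive_coord_jacobi.
Qed.

End RowVectors.

(* c' = X(c) makes (f o c)' = (D_X f) o c, so the regularity of f o c for all
   smooth f bootstraps. *)
Lemma smooth_integral_curve (R : realType) m (U : set 'rV[R]_m)
    (X : 'rV[R]_m -> 'rV[R]_m) (c : R -> 'rV[R]_m) (a : R) :
  open U -> (forall j, smooth_on U (fun z => X z 0 j : R)) ->
  (forall t : R, `|t| < a -> [/\ U (c t), derivable c t 1 & 'D_1 c t = X (c t)]) ->
  smooth_on [set t : R | `|t| < a] c.
Proof.
move=> oU sX hc.
have oI : open [set t : R | `|t| < a].
  have -> : [set t : R | `|t| < a] = ball (0 : R) a.
    by apply/seteqP; split => t; rewrite -ball_normE /= sub0r normrN.
  exact: ball_open.
have dc t : `|t| < a -> differentiable c t.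
  by move=> /hc[_ + _] => /derivable1_diffP.
suff main k (f : 'rV[R]_m -> R) : smooth_on U f ->
    Ck_on k [set t : R | `|t| < a] (fun t => f (c t)).
  apply: smooth_on_row => // j k; apply: (main k (fun z => z 0 j)).
  exact: smooth_on_coord.
elim: k f => [|k IH] f sf.
  move=> t ta; have [Uc _ _] := hc _ ta.
  apply: (continuous_comp (f := c)); first exact/differentiable_continuous/dc.
  exact: smooth_on_continuous sf Uc.
split=> [t ta|w].
  have [Uc _ _] := hc _ ta.
  apply: (differentiable_comp (f := c)); first exact: dc.
  exact: smooth_on_differentiable sf Uc.
pose Xf z := \sum_i X z 0 i * 'D_(delta_mx 0 i) f z.
have sXf : smooth_on U Xf.
  by apply: smooth_on_sum => // i; apply: smooth_onM => //; exact: smooth_on_derive.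
apply: (Ck_on_eq oI _ (Ck_onZl w oI (IH _ sXf))) => t ta.
have [Uc _ Dc] := hc _ ta.
have df := smooth_on_differentiable sf Uc.
have dfc : differentiable (fun t => f (c t)) t.
  by apply: (differentiable_comp (f := c)) => //; exact: dc.
rewrite [RHS]deriveE // diff1E // derive1E.
rewrite [X in w *: X](derive_comp (g := c)) ?Dc //; last exact: dc.
by rewrite derive_coord_sum //; exact: mulrC.
Qed.

(** * Local inversion along curves *)

Section LocalInversion.
Context {R : realType} {m : nat}.
Variables (A : set 'rV[R]_m) (Phi : 'rV[R]_m -> 'rV[R]_m) (u : 'rV[R]_m).
Hypotheses (oA : open A) (Au : A u).
Hypothesis sPhi : forall j, smooth_on A (fun z => Phi z 0 j : R).
Hypothesis jacobi_u : jacobi Phi u = 1%:M.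

Let dPhi j z : A z -> differentiable (fun z => Phi z 0 j : R) z.
Proof. exact: smooth_on_differentiable. Qed.

Lemma smooth_jacobi i j : smooth_on A (fun z => jacobi Phi z i j).
Proof.
apply: (smooth_on_eq (f := 'D_(delta_mx 0 i) (fun z => Phi z 0 j : R))) => //.
  by move=> z _; rewrite mxE.
exact: smooth_on_derive.
Qed.

Lemma smooth_det_jacobi : smooth_on A (fun z => \det (jacobi Phi z)).
Proof. by apply: smooth_on_det => // i j; exact: smooth_jacobi. Qed.

Lemma open_jacobi_unit : open (A `&` [set z | jacobi Phi z \in unitmx]).
Proof.
rewrite openE => z [Az uz]; rewrite /interior.
have c : {for z, continuous (fun z => \det (jacobi Phi z))}.
  exact: smooth_on_continuous smooth_det_jacobi Az.
move: uz; rewrite /= unitmxE unitfE => uz.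
have nA : \forall y \near z, A y by exact: open_nbhs_nbhs.
have nd : \forall y \near z, \det (jacobi Phi y) != 0.
  exact: (cvgr_neq0 (\det (jacobi Phi z)) c uz).
by apply: filterS2 nA nd => y Ay dy; split => //=; rewrite unitmxE unitfE.
Qed.

(** In the maximum norm the entry bound makes the identity minus [Phi] a contraction of ratio 1/2,
    since m/(2(m+1)) is at most 1/2. Taking m+1 keeps the bound positive for m = 0. *)
Let good r := forall z, `|z - u| <= r ->
  [/\ A z, jacobi Phi z \in unitmx &
     forall i j, `|(1%:M - jacobi Phi z) i j| <= (2 * m.+1%:R)^-1].

Lemma good_radius : exists2 r : R, 0 < r & good r.
Proof.
have n1 : nbhs u (A `&` [set z | jacobi Phi z \in unitmx]).
  by apply: open_nbhs_nbhs; split; [exact: open_jacobi_unit|rewrite /= jacobi_u unitmx1].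
have n2 : nbhs u [set z | forall ij,
    `|(1%:M - jacobi Phi z) ij.1 ij.2| <= (2 * m.+1%:R)^-1].
  apply: (@filter_forall _ ('I_m * 'I_m)%type (fun ij z =>
    `|(1%:M - jacobi Phi z) ij.1 ij.2| <= (2 * m.+1%:R)^-1) (nbhs u) _) => -[i j] /=.
  have c : {for u, continuous (fun z => jacobi Phi z i j)}.
    by apply: smooth_on_continuous Au; exact: smooth_jacobi.
  have e0 : 0 < (2 * m.+1%:R : R)^-1 by rewrite invr_gt0 mulr_gt0.
  have /cvgrPdist_lt/(_ _ e0) := c; apply: filterS => z /ltW.
  have -> : (1%:M - jacobi Phi z) i j = 1%:M i j - jacobi Phi z i j.
    by rewrite mxE [X in _ + X]mxE.
  by rewrite jacobi_u.
have [d /= d0 hd] := (nbhs_ballP _ _).1 (filterI n1 n2).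
(* Halving the radius fits the closed ball into the open one. *)
exists (d / 2) => [|z hz]; first by rewrite divr_gt0.
have [|[? ?] h] := hd z; last by split => // i j; exact: (h (i, j)).
rewrite -ball_normE /= distrC; apply: (le_lt_trans hz).
by rewrite gtr_pMr // invf_lt1 // ltr1n.
Qed.

Variable r : R.
Hypotheses (r0 : 0 < r) (gr : good r).

Lemma ball_segment z z' a : `|z - u| <= r -> `|z' - u| <= r -> 0 <= a <= 1 ->
  `|z' + a *: (z - z') - u| <= r.
Proof.
move=> hz hz' /andP[a0 a1].
have -> : z' + a *: (z - z') - u = (1 - a) *: (z' - u) + a *: (z - u).
  by apply/rowP => j; rewrite !mxE; ring.
rewrite (le_trans (ler_normD _ _)) // !normrZ (ger0_norm a0).
rewrite ger0_norm ?subr_ge0 // -[leRHS](subrK (a * r)) -{1}(mul1r r) -mulrBl.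
by apply: lerD; apply: ler_wpM2l; rewrite ?subr_ge0.
Qed.

(** The mean value theorem is for scalar functions, so it is applied to each coordinate [f] along
    the segment from [z'] to [z], on which the entries of the differential are bounded. *)
Lemma id_sub_contraction z z' : `|z - u| <= r -> `|z' - u| <= r ->
  `|(z - Phi z) - (z' - Phi z')| <= 2^-1 * `|z - z'|.
Proof.
move=> hz hz'; apply/norm_row_le => [|j]; first by rewrite mulr_ge0.
pose f (y : 'rV[R]_m) : R := y 0 j - Phi y 0 j.
have dc y : differentiable (fun z : 'rV[R]_m => z 0 j : R) y.
  exact: differentiable_coord.
have Df y w : A y -> is_derive y w f ((w *m (1%:M - jacobi Phi y)) 0 j).
  move=> Ay; have df : differentiable f y by apply: differentiableB => //; exact: dPhi.
  split; first exact: diff_derivable.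
  rewrite (deriveB (f := fun z : 'rV[R]_m => z 0 j : R)).
  - rewrite derive_coord (derive_coord_jacobi (f := Phi)).
    by rewrite mulmxBr mulmx1 [RHS]mxE; congr (_ + _); rewrite [RHS]mxE.
  - exact: dPhi.
  - exact: diff_derivable.
  - by apply: diff_derivable; exact: dPhi.
have [a ha E] : exists2 a, 0 <= a <= 1 &
    f (z' + 1 *: (z - z')) - f z' = 1 * 'D_(z - z') f (z' + a *: (z - z')).
  apply: MVT_line => // a ha.
  have [Aa _ _] := gr (ball_segment hz hz' ha).
  by apply: differentiableB => //; exact: dPhi.
have [Aa _ ga] := gr (ball_segment hz hz' ha).
move: E; rewrite scale1r subrKC mul1r; have [_ ->] := Df _ (z - z') Aa => E.
have -> : ((z - Phi z) - (z' - Phi z')) 0 j = f z - f z' by rewrite !mxE.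
rewrite E mxE (le_trans (ler_norm_sum _ _ _)) //.
apply: (@le_trans _ _ (\sum_(i < m) `|z - z'| * (2 * m.+1%:R)^-1)).
  by apply: ler_sum => i _; rewrite normrM ler_pM // ler_norm_coord.
rewrite sumr_const card_ord -(mulr_natr (`|z - z'| * _) m) -mulrA [leRHS]mulrC ler_wpM2l //.
rewrite invfM -mulrA ler_piMr // mulrC ler_pdivrMr // mul1r ler_nat.
exact: leqnSn.
Qed.

(** z - z' is the sum of Phi z - Phi z' and a term of norm at most half of |z - z'|, which is
    absorbed on the left. This gives injectivity and a Lipschitz inverse. *)
Lemma Phi_expansion z z' : `|z - u| <= r -> `|z' - u| <= r ->
  `|z - z'| <= 2 * `|Phi z - Phi z'|.
Proof.
move=> hz hz'; have h := id_sub_contraction hz hz'.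
have : `|z - z'| <= `|Phi z - Phi z'| + 2^-1 * `|z - z'|.
  apply: le_trans (lerD (lexx _) h); apply: le_trans (ler_normD _ _).
  rewrite le_eqVlt; apply/orP; left; apply/eqP; congr `|_|.
  by apply/rowP => j; rewrite !mxE; ring.
by lra.
Qed.

(** A solution is a fixed point of z |-> Phi u + w + (z - Phi z). The ball is preserved because [w]
    takes up at most half of the radius and the contraction the other half. *)
Lemma Phi_surjective w : `|w| <= r / 2 ->
  exists2 z, `|z - u| <= r & Phi z = Phi u + w.
Proof.
move=> hw; pose B := closed_ball u r.
have BE z : B z <-> `|z - u| <= r by rewrite /B closed_ballE // /closed_ball_ /= distrC.
have Bu : B u by apply/BE; rewrite subrr normr0 ltW.
pose f z := Phi u + w + (z - Phi z).
have fB : set_fun B B f.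
  move=> z /BE hz; apply/BE.
  have -> : f z - u = w + ((z - Phi z) - (u - Phi u)).
    by apply/rowP => j; rewrite !mxE; ring.
  rewrite (le_trans (ler_normD _ _)) // [r in leRHS](splitr r) lerD //.
  apply: le_trans (id_sub_contraction hz _) _; first exact/BE.
  by move: hz; lra.
have [|||z /BE hz fz] := @banach_fixed_point R _ B (mkfun_fun fB).
- exists (2^-1)%:nng; split => /=; first by rewrite invf_lt1 // ltr1n.
  move=> [z z'] [/= /BE hz /BE hz'].
  rewrite /mkfun /f opprD addrACA subrr add0r.
  exact: id_sub_contraction.
- exact: closed_ball_closed.
- by exists u.
exists z => //; move/rowP: fz => fz; apply/rowP => j.
by have := fz j; rewrite /mkfun /= /f !mxE => E; lra.
Qed.

(** With D the increment of [c] over [h], expanding [Phi] at [c t] gives h x = D N + o(D), while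
    [Phi_expansion] gives D = O(h). Multiplying by the inverse of N yields the limit of D/h. *)
Lemma inverse_curve_derivable (x : 'rV[R]_m) (c : R -> 'rV[R]_m) (a t : R) :
  (forall t, `|t| < a -> `|c t - u| <= r /\ Phi (c t) = Phi u + t *: x) ->
  `|t| < a -> is_derive t (1 : R) c (x *m invmx (jacobi Phi (c t))).
Proof.
move=> hc ta; set N := jacobi Phi (c t).
have [ct Pct] := hc _ ta.
have [Act uN _] := gr ct.
set X := x *m invmx N.
suff lim_q : h^-1 *: (c (h + t) - c t) @[h --> 0^'] --> X.
  have lim_q' : h^-1 *: ((c \o shift t) (h *: 1) - c t) @[h --> 0^'] --> X.
    by under eq_fun do rewrite /= [_ *: 1]mulr1.
  by split; [apply/cvg_ex; exists X|exact: cvg_lim].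
have dPt : differentiable Phi (c t).
  by apply: differentiable_row => j; exact: dPhi.
have dE k : 'd Phi (c t) k = k *m N.
  by rewrite -deriveE // derive_jacobi // => j; exact: dPhi.
have [C C0 hC] := linear_lipschitz
  (linear_row_continuous (l := mulmxr (invmx N) : {linear 'rV[R]_m -> 'rV[R]_m})).
apply/cvgrPdist_le => e e0.
(* [b] dominates 2 |x| and stays positive when [x] vanishes; [C] is a Lipschitz constant of
   multiplication by the inverse of [N]. *)
pose b := 2 * `|x| + 1.
have b0 : 0 < b by rewrite ltr_wpDl // mulr_ge0.
have eps0 : 0 < e / (C * b) by rewrite divr_gt0 // mulr_gt0.
have /eqaddoP/(_ _ eps0) := diff_locally dPt.
move=> /nbhs_ballP[d /= d0 hd].
have db0 : 0 < Num.min (a - `|t|) (d / b).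
  by rewrite lt_min subr_gt0 ta divr_gt0.
near=> h.
have h0 : h != 0 by near: h; exact: nbhs_dnbhs_neq.
have : `|h| < Num.min (a - `|t|) (d / b) by near: h; exact: dnbhs0_lt.
rewrite lt_min ltrBrDr => /andP[hta hdb].
have [ch Pch] := hc _ (le_lt_trans (ler_normD h t) hta).
pose D := c (h + t) - c t.
have D_le : `|D| <= 2 * (`|h| * `|x|).
  rewrite (le_trans (Phi_expansion ch ct)) // Pch Pct.
  by rewrite opprD addrACA subrr add0r -scalerBl addrK normrZ.
have /hd : ball 0 d D.
  rewrite -ball_normE /= sub0r normrN (le_lt_trans D_le) //.
  apply: (@le_lt_trans _ _ (`|h| * b)); last by rewrite -ltr_pdivlMr.
  by rewrite /b mulrCA mulrDr mulr1 lerDl.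
rewrite /= !fctE /= dE subrK Pch Pct => hD.
have E : X - h^-1 *: D = (h^-1 *: (h *: x - D *m N)) *m invmx N.
  by rewrite (scalerBr _ (h *: x)) scalerA mulVf // scale1r mulmxBl -scalemxAl mulmxK.
rewrite E (le_trans (hC _)) // normrZ normfV.
have {}hD : `|h *: x - D *m N| <= e / (C * b) * (2 * (`|h| * `|x|)).
  apply: le_trans (ler_wpM2l (ltW eps0) D_le); apply: le_trans hD.
  rewrite le_eqVlt; apply/orP; left; apply/eqP; congr `|_|.
  by rewrite scalerDl opprD addrA; apply/rowP => j; rewrite !mxE; ring.
apply: (@le_trans _ _ (C * (`|h|^-1 * (e / (C * b) * (2 * (`|h| * `|x|)))))).
  by rewrite ler_pM2l // ler_wpM2l.
have -> : C * (`|h|^-1 * (e / (C * b) * (2 * (`|h| * `|x|)))) = e * (2 * `|x| / b).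
  by field; rewrite !gt_eqF // normr_gt0.
by rewrite ler_piMr ?(ltW e0) // ler_pdivrMr // mul1r /b lerDl.
Unshelve. all: by end_near. Qed.

Lemma inverse_curve (x : 'rV[R]_m) : exists (a : R) (c : R -> 'rV[R]_m),
  [/\ 0 < a, smooth_on [set t : R | `|t| < a] c,
     forall t, `|t| < a -> A (c t) /\ Phi (c t) = Phi u + t *: x,
     c 0 = u & 'D_1 c 0 = x].
Proof.
(* Chosen so that |t| < a forces |t x| <= r/2, the range of [Phi_surjective]. *)
pose a := r / (2 * (1 + `|x|)).
have x0 : 0 < 1 + `|x| by rewrite ltr_wpDr.
have a0 : 0 < a by rewrite divr_gt0 // mulr_gt0.
have /choice[c hc] : forall t : R, exists z, `|t| < a ->
    `|z - u| <= r /\ Phi z = Phi u + t *: x.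
  move=> t; have [ta|ta] := ltP `|t| a; last by exists 0.
  have [|z h1 h2] := @Phi_surjective (t *: x); last by exists z.
  rewrite normrZ (@le_trans _ _ (a * (1 + `|x|))) //.
    by apply: ler_pM => //; [exact: ltW|rewrite lerDr].
  by rewrite /a invfM mulrA mulfVK ?gt_eqF.
have a00 : `|0 : R| < a by rewrite normr0.
have c0 : c 0 = u.
  have [h1 h2] := hc _ a00.
  apply/eqP; rewrite -subr_eq0 -normr_le0.
  have uu : `|u - u| <= r by rewrite subrr normr0 ltW.
  rewrite (le_trans (Phi_expansion h1 uu)) // h2.
  by rewrite scale0r addr0 subrr normr0 mulr0.
have cd t : `|t| < a -> _ := inverse_curve_derivable hc.
exists a, c; split => //.
(* The curve is an integral curve of the vector field z |-> x J(z)^-1, with J the Jacobian, which is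
   smooth where J is invertible. *)
- apply: (smooth_integral_curve (X := fun z => x *m invmx (jacobi Phi z))
      open_jacobi_unit) => [j|t ta].
    apply: (smooth_on_eq
      (f := fun z => \sum_i x 0 i * invmx (jacobi Phi z) i j)).
    + exact: open_jacobi_unit.
    + by move=> z _; rewrite mxE.
    apply: smooth_on_sum => [|i]; first exact: open_jacobi_unit.
    apply: smooth_onM; [exact: open_jacobi_unit|exact: smooth_on_cst|].
    apply: smooth_on_invmx => [|i' j'|z []//]; first exact: open_jacobi_unit.
    by apply: smooth_on_sub (@smooth_jacobi i' j') => z [].
  have [h1 h2] := hc _ ta; have [h3 h4 _] := gr h1; have [d1 d2] := cd _ ta.
  by split.
- by move=> t ta; have [h1 h2] := hc _ ta; have [h3 _ _] := gr h1.
- by have [_ ->] := cd _ a00; rewrite c0 jacobi_u invmx1 mulmx1.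
Qed.

End LocalInversion.

(** The form of the inverse function theorem used below: lifting straight lines is enough to produce
    tangent vectors, these being velocities of curves. *)
Lemma local_inverse_curve (R : realType) m (A : set 'rV[R]_m)
    (Phi : 'rV[R]_m -> 'rV[R]_m) (u : 'rV[R]_m) : open A -> A u ->
  (forall j, smooth_on A (fun z => Phi z 0 j : R)) -> jacobi Phi u = 1%:M ->
  forall x : 'rV[R]_m, exists (a : R) (c : R -> 'rV[R]_m),
  [/\ 0 < a, smooth_on [set t : R | `|t| < a] c,
     forall t, `|t| < a -> A (c t) /\ Phi (c t) = Phi u + t *: x,
     c 0 = u & 'D_1 c 0 = x].
Proof.
move=> oA Au sPhi J1 x; have [r r0 gr] := good_radius oA Au sPhi J1.
exact: inverse_curve gr x.
Qed.

(** * Derivatives in varying directions and along tangent vectors *)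

Section DirectionalDerivatives.
Context {R : realType}.

Lemma derive_dirD (V W : normedModType R) (f : V -> W) (u x y : V) :
  differentiable f u -> 'D_(x + y) f u = 'D_x f u + 'D_y f u.
Proof. by move=> df; rewrite !deriveE // linearD. Qed.

Lemma derive_mulmxr m n (T : 'M[R]_(m, n)) (u x : 'rV[R]_m) :
  'D_x (mulmxr T : 'rV[R]_m -> 'rV[R]_n) u = x *m T.
Proof.
exact: (derive_lin (l := mulmxr T : {linear 'rV[R]_m -> 'rV[R]_n}) u x
  (@linear_row_continuous _ _ _ _)).
Qed.

Lemma derive_second_sum m (A : set 'rV[R]_m) (G : 'rV[R]_m -> R)
    (u x y : 'rV[R]_m) : open A -> smooth_on A G -> A u ->
  'D_x ('D_y G) u = \sum_i y 0 i *: 'D_x ('D_(delta_mx 0 i) G) u.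
Proof.
move=> oA sG Au.
have dG i : derivable ('D_(delta_mx 0 i) G) u x.
  exact/diff_derivable/(smooth_on_differentiable (smooth_on_derive _ sG) Au).
pose h i : 'rV[R]_m -> R := y 0 i *: 'D_(delta_mx 0 i) G.
have -> : 'D_x ('D_y G) u = 'D_x (\sum_i h i) u.
  apply: near_eq_derive.
  have : \forall z \near u, A z by exact: open_nbhs_nbhs.
  apply: filterS => z Az; rewrite fct_sumE derive_coord_sum //.
  exact: smooth_on_differentiable sG Az.
rewrite derive_sum => [|i]; last exact: derivableZ.
by apply: eq_bigr => i _; rewrite deriveZ.
Qed.

(** Expanding the derivative along [Y z] in partial derivatives reduces this to the product and
    chain rules: one term differentiates the direction, the other the base point. *)
Lemma is_derive_leibniz (V : normedModType R) m (A : set 'rV[R]_m)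
    (G : 'rV[R]_m -> R) (S Y : V -> 'rV[R]_m) (u x : V) :
  open A -> smooth_on A G -> A (S u) -> differentiable S u ->
  (forall i, differentiable (fun z => Y z 0 i : R) u) ->
  differentiable (fun z => 'D_(Y z) G (S z)) u /\
  'D_x (fun z => 'D_(Y z) G (S z)) u =
    'D_('D_x Y u) G (S u) + 'D_('D_x S u) ('D_(Y u) G) (S u).
Proof.
move=> oA sG AS dS dY.
pose G' i : 'rV[R]_m -> R := 'D_(delta_mx 0 i) G.
have dG' i : differentiable (fun z => G' i (S z)) u.
  apply: (differentiable_comp (f := S)) => //.
  exact: smooth_on_differentiable (smooth_on_derive _ sG) AS.
pose h i (z : V) : R := Y z 0 i * G' i (S z).
have dh i : differentiable (h i) u.
  exact: (differentiableM (f := fun z => Y z 0 i : R)).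
have E : \near u, (\sum_i h i) u = 'D_(Y u) G (S u).
  have : \forall z \near u, A (S z).
    apply: (differentiable_continuous dS); exact: open_nbhs_nbhs.
  apply: filterS => z Az; rewrite fct_sumE derive_coord_sum //.
  exact: smooth_on_differentiable sG Az.
have dE : differentiable (\sum_i h i) u by exact: differentiable_sum.
split; first exact: near_eq_differentiable E dE.
rewrite -(near_eq_derive x E) derive_sum => [|i]; last exact: diff_derivable.
rewrite derive_coord_sum; last exact: smooth_on_differentiable sG AS.
rewrite (derive_second_sum _ _ oA sG AS) -big_split /=.
apply: eq_bigr => i _.
rewrite (deriveM (f := fun z => Y z 0 i : R)); last 2 first.
- exact: diff_derivable.
- exact: diff_derivable.
rewrite (derive_comp (g := S)) //; last first.
  exact: smooth_on_differentiable (smooth_on_derive _ sG) AS.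
rewrite addrC; congr (_ + _); rewrite derive_mx ?mxE; last first.
  by apply: diff_derivable; exact: differentiable_row.
exact: mulrC.
Qed.

End DirectionalDerivatives.

(** A tangent vector is the velocity of a curve in [H], along which [f] and [g] agree for small
    times; the chain rule concludes. *)
Lemma tangent_derive_eq (R : realType) (V : normedModType R) (H U : set V)
    (f g : V -> R) (u x : V) :
  tangent_space H u x -> open U -> U u ->
  (forall z, U z -> H z -> f z = g z) ->
  differentiable f u -> differentiable g u -> 'D_x f u = 'D_x g u.
Proof.
move=> [a a0 [c [sc Hc cu Dc]]] oU Uu fg df dg.
have a00 : `|0 : R| < a by rewrite normr0.
have dc : differentiable c 0 by exact: smooth_on_differentiable sc _.
rewrite -Dc -cu -!derive_comp ?cu //.
apply: near_eq_derive.
have nU : \forall t \near (0 : R), U (c t).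
  by apply: (differentiable_continuous dc); rewrite cu; exact: open_nbhs_nbhs.
have na : \forall t \near (0 : R), `|t| < a by exact: nbhs0_lt.
by apply: filterS2 nU na => t Ut ta; apply: fg => //; exact: Hc.
Qed.

(** * Pseudo-Finsler submersions at one point *)

Section HessianMatrix.
Context {R : realType} {m : nat}.
Variables (A : set 'rV[R]_m) (F : 'rV[R]_m -> R).
Hypotheses (oA : open A) (sF : smooth_on A F).

Definition gradient (u : 'rV[R]_m) : 'rV[R]_m := \row_j 'D_(delta_mx 0 j) F u.

Definition hessian (u : 'rV[R]_m) : 'M[R]_m := jacobi gradient u.

Lemma gradient_coordE j :
  (fun z => gradient z 0 j) = 'D_(delta_mx 0 j) F :> (_ -> R).
Proof. by apply/funext => z; rewrite mxE. Qed.

Lemma smooth_gradient j : smooth_on A (fun z => gradient z 0 j : R).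
Proof. by rewrite gradient_coordE; exact: smooth_on_derive. Qed.

Lemma derive_gradient u w : A u -> 'D_w F u = (gradient u *m w^T) 0 0.
Proof.
move=> Au; rewrite derive_coord_sum; last exact: smooth_on_differentiable sF Au.
by rewrite mxE; apply: eq_bigr => i _; rewrite !mxE; exact: mulrC.
Qed.

Lemma derive_hessian u x y : A u -> 'D_x ('D_y F) u = (x *m hessian u *m y^T) 0 0.
Proof.
move=> Au; rewrite (derive_second_sum _ _ oA sF Au) mxE.
apply: eq_bigr => j _; rewrite -gradient_coordE derive_coord_jacobi; last first.
  exact: smooth_on_differentiable (smooth_gradient _) Au.
by rewrite [X in _ = _ * X]mxE; exact: mulrC.
Qed.

End HessianMatrix.

Lemma kernel_basis (R : realType) m n (T : 'M[R]_(m, n)) :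
  exists (k : nat) (K : 'M[R]_(k, m)), row_free K /\
    forall w : 'rV[R]_m, w *m T = 0 <-> exists w', w = w' *m K.
Proof.
exists (\rank (kermx T)), (row_base (kermx T)); split=> [|w].
  exact: row_base_free.
split=> [wT|[w' ->]].
  have : (w <= row_base (kermx T))%MS by rewrite eq_row_base; apply/sub_kermxP.
  by move=> /submxP[w' ->]; exists w'.
rewrite -mulmxA; have : (row_base (kermx T) <= kermx T)%MS by rewrite eq_row_base.
by move=> /sub_kermxP ->; rewrite mulmx0.
Qed.

(** The final bookkeeping: [a] and [d] are the third derivatives of [F] and [Ft], [b] comes from the
    second fundamental form, and [c] is the common contribution of the derivative of the tangent
    field. *)
Lemma quarter_split (R : realFieldType) (a b c d : R) :
  c + b + a = c + d -> 4^-1 * a = 4^-1 * d - 2^-1 * (2^-1 * b).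
Proof. by move=> ?; lra. Qed.

(** * One tangent space: projections, straightening, tangent and normal spaces of [H] *)

Section LinearSubmersion.
Context {R : realType} {m n : nat}.
Variables (A : set 'rV[R]_m) (F : 'rV[R]_m -> R).
Hypotheses (oA : open A) (sF : smooth_on A F).
Variables (T : 'M[R]_(m, n)) (H : set 'rV[R]_m).
Hypothesis HE : forall u, H u <-> A u /\ forall w : 'rV[R]_m, w *m T = 0 -> 'D_w F u = 0.
Hypothesis nondeg : forall u, A u -> forall e,
  (forall h, 'D_e ('D_h F) u = 0) -> e = 0.
Hypothesis nondegV : forall u, H u -> forall e : 'rV[R]_m, e *m T = 0 ->
  (forall h : 'rV[R]_m, h *m T = 0 -> 'D_e ('D_h F) u = 0) -> e = 0.

Variables (k : nat) (K : 'M[R]_(k, m)).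
Hypothesis Kfree : row_free K.
Hypothesis KP : forall w : 'rV[R]_m, w *m T = 0 <-> exists w', w = w' *m K.

Let G u := hessian F u.
(** The Gram matrix of the vertical basis [K] for the Hessian, which is twice the fundamental
    tensor. *)
Let gram u : 'M[R]_k := K *m G u *m K^T.

Lemma covector_ker (r : 'rV[R]_m) :
  (forall w : 'rV[R]_m, w *m T = 0 -> (r *m w^T) 0 0 = 0) <-> r *m K^T = 0.
Proof.
split=> [h|h w /KP[w' ->]]; last by rewrite trmx_mul mulmxA h mul0mx mxE.
apply/rowP => i; rewrite [RHS]mxE.
have /h : (delta_mx 0 i : 'rV[R]_k) *m K *m T = 0 by apply/KP; exists (delta_mx 0 i).
by rewrite trmx_mul mulmxA trmx_delta -colE [in X in X -> _]mxE.
Qed.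

(* [gram_sharp u] turns a covector into the vertical vector that represents its
   restriction to the vertical space, so [vproj u] is the g_u-orthogonal
   projection onto the vertical space. *)
Definition gram_sharp u : 'M[R]_m := K^T *m invmx (gram u) *m K.
Definition vproj u : 'M[R]_m := G u *m gram_sharp u.

Definition ghor u : set 'rV[R]_m :=
  [set x | forall w : 'rV[R]_m, w *m T = 0 -> 'D_x ('D_w F) u = 0].

Let HA u : H u -> A u. Proof. by move=> /HE[]. Qed.

Lemma H_gradient u : H u <-> A u /\ gradient F u *m K^T = 0.
Proof.
rewrite HE; split=> -[Au h]; split => //.
  by apply/covector_ker => w /h; rewrite (derive_gradient sF).
by move=> w wT; rewrite (derive_gradient sF) //; move: w wT; apply/covector_ker.
Qed.

Lemma ghorP u (x : 'rV[R]_m) : A u -> ghor u x <-> x *m G u *m K^T = 0.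
Proof.
move=> Au; rewrite -covector_ker; split=> h w /h.
  by rewrite (derive_hessian oA sF).
by rewrite (derive_hessian oA sF).
Qed.

Lemma KT0 : K *m T = 0.
Proof.
by apply/row_matrixP => i; rewrite row_mul row0; apply/KP; exists (delta_mx 0 i); rewrite rowE.
Qed.

Lemma vproj_vertical u (x : 'rV[R]_m) : x *m vproj u *m T = 0.
Proof. by rewrite /vproj /gram_sharp -!mulmxA KT0 !mulmx0. Qed.

(** A row [v] in the kernel gives the vertical vector [v *m K], orthogonal to all vertical vectors,
    hence zero by non-degeneracy on the vertical space. *)
Lemma gram_unit u : H u -> gram u \in unitmx.
Proof.
move=> Hu; rewrite -row_free_unit; apply: inj_row_free => v vG.
have : v *m K = 0.
  apply: (nondegV Hu); first by rewrite -mulmxA KT0 mulmx0.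
  apply/(ghorP _ (HA Hu)); by rewrite -vG /gram !mulmxA.
by move=> vK; apply: (row_free_inj Kfree); rewrite mul0mx.
Qed.

Lemma sharp_vproj u : H u -> gram_sharp u *m vproj u = gram_sharp u.
Proof.
move=> Hu; rewrite /vproj /gram_sharp !mulmxA.
have -> : K^T *m invmx (gram u) *m K *m G u *m K^T = K^T *m invmx (gram u) *m gram u.
  by rewrite /gram !mulmxA.
by rewrite mulmxKV // gram_unit.
Qed.

Lemma vproj_idem u : H u -> vproj u *m vproj u = vproj u.
Proof. by move=> Hu; rewrite {1}/vproj -mulmxA sharp_vproj. Qed.

Lemma mul_sharp_eq0 u (r : 'rV[R]_m) : H u ->
  r *m gram_sharp u = 0 <-> r *m K^T = 0.
Proof.
move=> Hu; rewrite /gram_sharp !mulmxA; split=> [h|->]; last by rewrite !mul0mx.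
have : r *m K^T *m invmx (gram u) = 0.
  by apply: (row_free_inj Kfree); rewrite mul0mx.
move=> /(congr1 (mulmx^~ (gram u))).
by rewrite mulmxKV ?gram_unit // mul0mx.
Qed.

Lemma ghor_vproj u (x : 'rV[R]_m) : H u -> ghor u x <-> x *m vproj u = 0.
Proof.
by move=> Hu; rewrite (ghorP x (HA Hu)) -(mul_sharp_eq0 _ Hu) /vproj mulmxA.
Qed.

Lemma ghor_sub_vproj u (z : 'rV[R]_m) : H u -> ghor u (z - z *m vproj u).
Proof.
move=> Hu; apply/(ghor_vproj _ Hu).
by rewrite mulmxBl -(mulmxA z) (vproj_idem Hu) subrr.
Qed.

(* A map with differential [1] at [v] that straightens [H] near [v]. *)
Definition straighten v (z : 'rV[R]_m) : 'rV[R]_m :=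
  z - z *m vproj v + gradient F z *m gram_sharp v.

Lemma straighten_smooth v j : smooth_on A (fun z => straighten v z 0 j : R).
Proof.
have E z : straighten v z 0 j = z 0 j + (-1) * (\sum_i z 0 i * vproj v i j)
    + \sum_i gradient F z 0 i * gram_sharp v i j.
  by rewrite 3!mxE mulN1r 2!mxE.
apply: (smooth_on_eq oA (fun z _ => esym (E z))).
have c (r : R) : smooth_on A (fun _ : 'rV[R]_m => r) by exact: smooth_on_cst.
apply: smooth_onD => //; first apply: smooth_onD => //.
- exact: smooth_on_coord.
- apply: smooth_onM => //; apply: smooth_on_sum => // i; apply: smooth_onM => //.
  exact: smooth_on_coord.
- apply: smooth_on_sum => // i; apply: smooth_onM => //.
  exact: smooth_gradient.
Qed.

Lemma jacobi_straighten v z : A z ->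
  jacobi (straighten v) z = 1%:M - vproj v + G z *m gram_sharp v.
Proof.
move=> Az; apply/row_matrixP => i; rewrite !rowE.
have dS j : differentiable (fun z => straighten v z 0 j : R) z.
  exact: smooth_on_differentiable (straighten_smooth _ _) Az.
have dg : differentiable (gradient F) z.
  by apply: differentiable_row => j; exact: smooth_on_differentiable (smooth_gradient sF _) Az.
rewrite -derive_jacobi //; set w := delta_mx 0 i.
pose l1 : {linear 'rV[R]_m -> 'rV[R]_m} := mulmxr (1%:M - vproj v).
pose l2 : {linear 'rV[R]_m -> 'rV[R]_m} := mulmxr (gram_sharp v).
have -> : straighten v = (l1 : _ -> _) + (l2 \o gradient F).
  by apply/funext => y; rewrite /straighten !fctE /= mulmxBr mulmx1.
have d1 : differentiable l1 z by exact: linear_row_differentiable.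
have d2 y : differentiable l2 y by exact: linear_row_differentiable.
rewrite deriveD; last 2 first.
- exact: diff_derivable.
- by apply: diff_derivable; exact: differentiable_comp.
rewrite derive_comp // !derive_mulmxr derive_jacobi; last first.
  by move=> j; exact: smooth_on_differentiable (smooth_gradient sF _) Az.
by rewrite [RHS]mulmxDr [in RHS]mulmxA.
Qed.

(** At [v] the last two terms of the differential cancel, by the definition of [vproj]. *)
Lemma jacobi_straighten_id v : H v -> jacobi (straighten v) v = 1%:M.
Proof. by move=> Hv; rewrite jacobi_straighten ?subrK //; exact: HA. Qed.

(** The vertical part of [straighten v z] vanishes exactly when dF_z kills the vertical space. So
    within [A] the set [H] is the preimage of the linear space of g_v-horizontal vectors. *)
Lemma straighten_vproj v z : H v ->
  straighten v z *m vproj v = gradient F z *m gram_sharp v.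
Proof.
move=> Hv; rewrite /straighten mulmxDl mulmxBl.
rewrite -(mulmxA z) -(mulmxA _ _ (vproj v)) (vproj_idem Hv).
by rewrite (sharp_vproj Hv) subrr add0r.
Qed.

(** The differentiated form of [straighten_vproj]: the differential at [z] sends precisely the
    g_z-horizontal vectors to g_v-horizontal ones. *)
Lemma jacobi_straighten_vproj v z : H v -> A z ->
  jacobi (straighten v) z *m vproj v = G z *m gram_sharp v.
Proof.
move=> Hv Az; rewrite jacobi_straighten //.
move: (G z) (vproj v) (gram_sharp v) (vproj_idem Hv) (sharp_vproj Hv) => G' V S VV SV.
by rewrite mulmxDl mulmxBl mul1mx VV -mulmxA SV subrr add0r.
Qed.

(** Moving along a g_u-horizontal [x] keeps the vertical part of the straightened point equal to its
    value 0 at [u], so the lift of this line is a curve in [H]. *)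
Lemma ghor_tangent u (x : 'rV[R]_m) : H u -> ghor u x -> tangent_space H u x.
Proof.
move=> Hu /(ghor_vproj _ Hu) xP; have Au := HA Hu.
have [a [c [a0 sc hc c0 Dc]]] := local_inverse_curve oA Au (straighten_smooth u)
  (jacobi_straighten_id Hu) x.
exists a => //; exists c; split => // t ta.
have [At Pt] := hc _ ta.
apply/H_gradient; split => //; apply/(mul_sharp_eq0 _ Hu).
rewrite -straighten_vproj // Pt mulmxDl -scalemxAl xP scaler0 addr0.
rewrite straighten_vproj //; apply/(mul_sharp_eq0 _ Hu).
by have [] := (H_gradient u).1 Hu.
Qed.

(** For vertical [w] the function D_w F vanishes on [H], hence so does its derivative along tangent
    vectors. *)
Lemma tangent_ghor u (x : 'rV[R]_m) : H u -> tangent_space H u x -> ghor u x.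
Proof.
move=> Hu tx w wT; have Au := HA Hu.
rewrite (@tangent_derive_eq _ _ H A ('D_w F) (fun=> 0) u x tx) //.
- exact: derive_cst.
- by move=> z _ /HE[_]; apply.
- exact: smooth_on_differentiable (smooth_on_derive _ sF) Au.
Qed.

Lemma derive_sym x y u : A u -> 'D_x ('D_y F) u = 'D_y ('D_x F) u.
Proof. by move=> Au; exact: (derive_schwarz oA sF). Qed.

Let dF u : A u -> differentiable F u.
Proof. exact: smooth_on_differentiable. Qed.

Let dDF u y : A u -> differentiable ('D_y F) u.
Proof. exact/smooth_on_differentiable/smooth_on_derive. Qed.

Lemma derive_second_dirD u x a b : A u ->
  'D_x ('D_(a + b) F) u = 'D_x ('D_a F) u + 'D_x ('D_b F) u.
Proof.
move=> Au; rewrite (derive_sym x a Au) (derive_sym x b Au) (derive_sym x (a + b) Au).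
exact: derive_dirD (dDF _ Au).
Qed.

(** The horizontal part of [w] is orthogonal to vertical vectors by construction, and to horizontal
    ones because these are tangent and [w] is normal; non-degeneracy makes it zero. *)
Lemma normal_vertical v (w : 'rV[R]_m) : H v ->
  normal_space H (fundamental_tensor F v) v w -> w *m T = 0.
Proof.
move=> Hv nw; have Av := HA Hv.
have nw' x : ghor v x -> 'D_w ('D_x F) v = 0.
  move=> gx; have := nw _ (ghor_tangent Hv gx).
  rewrite fundamental_tensorE => /eqP; rewrite mulf_eq0 invr_eq0 pnatr_eq0 /=.
  by move/eqP.
move: (vproj v) (vproj_vertical v) (fun z => ghor_sub_vproj z Hv) => V vert hor.
suff : w - w *m V = 0.
  by move=> /eqP; rewrite subr_eq0 => /eqP ->; exact: vert.
apply: (nondeg Av) => h.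
rewrite -[h](subrK (h *m V)) (derive_second_dirD _ _ _ Av) (hor w _ (vert h)) addr0.
have := derive_dirD (w - w *m V) (w *m V) (dDF (h - h *m V) Av).
rewrite subrK (nw' _ (hor h)) (derive_sym (w *m V) _ Av) (hor h _ (vert w)) addr0.
by move=> <-.
Qed.

Lemma second_fundamental_form_exists v (x y : 'rV[R]_m) : H v -> ghor v y ->
  exists w, is_second_fundamental_form H (fundamental_tensor F v) v x y w.
Proof.
move=> Hv gy; have Av := HA Hv.
pose J z := jacobi (straighten v) z.
pose U := A `&` [set z | J z \in unitmx].
have oU : open U by exact: (open_jacobi_unit oA (straighten_smooth v)).
(* [Y] is the constant field [y] pulled back by the straightening map, hence tangent to [H]; the
   vertical part of its derivative is the required normal component. *)
pose Y z := y *m invmx (J z).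
have sY : smooth_on U Y.
  apply: smooth_on_row => // j.
  apply: (smooth_on_eq (f := fun z => \sum_i y 0 i * invmx (J z) i j)) => //.
    by move=> z _; rewrite mxE.
  apply: smooth_on_sum => // i; apply: smooth_onM => //; first exact: smooth_on_cst.
  apply: smooth_on_invmx => // [i' j'|z []//].
  apply: (@smooth_on_sub _ _ _ A); first by move=> z [].
  exact: (smooth_jacobi oA (straighten_smooth v)).
exists ('D_x Y v *m vproj v), U, Y; split => //.
- by split => //; split => //=; rewrite /J jacobi_straighten_id // unitmx1.
- move=> u [Au uJ] Hu; apply: (ghor_tangent Hu); apply/(ghorP _ Au).
  apply/(mul_sharp_eq0 _ Hv); rewrite -mulmxA -jacobi_straighten_vproj // mulmxA.
  by rewrite mulmxKV //; apply/(ghor_vproj _ Hv).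
- by rewrite /Y /J jacobi_straighten_id // invmx1 mulmx1.
- split; last exact/(ghor_tangent Hv)/ghor_sub_vproj.
  move=> t /(tangent_ghor Hv) gt; rewrite fundamental_tensorE derive_sym //.
  by rewrite gt ?mulr0 // vproj_vertical.
Qed.

(** * Comparison of the derivatives of [F] and [Ft] *)

Section Submersion.
Variables (B : set 'rV[R]_n) (Ft : 'rV[R]_n -> R).
Hypotheses (oB : open B) (sFt : smooth_on B Ft).
Hypothesis HB : forall u, H u -> B (u *m T) /\ F u = Ft (u *m T).

Let S : {linear 'rV[R]_m -> 'rV[R]_n} := mulmxr T.

Let dS u : differentiable S u. Proof. exact: linear_row_differentiable. Qed.

Let dFt u : H u -> differentiable Ft (S u).
Proof. by move=> /HB[+ _]; exact: smooth_on_differentiable. Qed.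

Let dDFt u y : H u -> differentiable ('D_y Ft) (S u).
Proof.
by move=> /HB[+ _]; exact/smooth_on_differentiable/smooth_on_derive.
Qed.

Lemma derive_submersion u (z : 'rV[R]_m) : H u -> 'D_z F u = 'D_(z *m T) Ft (u *m T).
Proof.
move=> Hu; have Au := HA Hu.
have dFS : differentiable (Ft \o S) u by exact: differentiable_comp (dS u) (dFt Hu).
move: (vproj u) (vproj_vertical u) (fun z => ghor_sub_vproj z Hu) => V vert hor.
have Fz := derive_dirD (z - z *m V) (z *m V) (dF Au).
rewrite subrK (((HE u).1 Hu).2 _ (vert z)) addr0 in Fz; rewrite {}Fz.
have -> := tangent_derive_eq (ghor_tangent Hu (hor z)) oA Au
  (fun w _ Hw => (HB Hw).2) (dF Au) dFS.
by rewrite (derive_comp _ (dS u) (dFt Hu)) derive_mulmxr mulmxBl vert subr0.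
Qed.

Lemma derive2_submersion u (x z : 'rV[R]_m) : H u -> ghor u x ->
  'D_x ('D_z F) u = 'D_(x *m T) ('D_(z *m T) Ft) (u *m T).
Proof.
move=> Hu gx; have Au := HA Hu.
have dDFS : differentiable ('D_(z *m T) Ft \o S) u.
  exact: differentiable_comp (dS u) (dDFt _ Hu).
have -> := tangent_derive_eq (ghor_tangent Hu gx) oA Au
  (fun w _ Hw => derive_submersion z Hw) (dDF z Au) dDFS.
by rewrite (derive_comp _ (dS u) (dDFt _ Hu)) derive_mulmxr.
Qed.

(** The formula is proved for every [w] satisfying the definition, whatever tangent extension [Y]
    produced it. *)
Lemma cartan_tensor_submersion v (x y e w : 'rV[R]_m) : H v -> ghor v x -> ghor v y ->
  is_second_fundamental_form H (fundamental_tensor F v) v x y w ->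
  cartan_tensor F v x y e =
    cartan_tensor Ft (v *m T) (x *m T) (y *m T) (e *m T)
    - 2^-1 * fundamental_tensor F v w e.
Proof.
move=> Hv gx gy [U [Y [[oU Uv] sY HY Yv [nw tw]]]]; have Av := HA Hv.
have wT := normal_vertical Hv nw.
have dY : differentiable Y v by exact: smooth_on_differentiable sY Uv.
have dYj j : differentiable (fun z => Y z 0 j : R) v.
  apply: (differentiable_comp (f := Y) (g := fun z : 'rV[R]_m => z 0 j : R)) => //.
  exact: differentiable_coord.
have dSYj j : differentiable (fun z => (Y z *m T) 0 j : R) v.
  apply: (differentiable_comp (f := S \o Y) (g := fun z : 'rV[R]_n => z 0 j : R)).
    exact: differentiable_comp.
  exact: differentiable_coord.
have [d1 D1] := @is_derive_leibniz R _ _ A ('D_e F) id Y v x oA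
  (smooth_on_derive e sF) Av (differentiable_id v) dYj.
have [d2 D2] := @is_derive_leibniz R _ _ B ('D_(e *m T) Ft) S (S \o Y) v x oB
  (smooth_on_derive _ sFt) (HB Hv).1 (dS v) dSYj.
(* The two functions are known to agree only on [H] near [v], which suffices since [x] is tangent to
   [H]. *)
have E : 'D_x (fun z => 'D_(Y z) ('D_e F) z) v =
    'D_x (fun z => 'D_((S \o Y) z) ('D_(e *m T) Ft) (S z)) v.
  have oUA : open (U `&` A) by exact: openI.
  apply: (tangent_derive_eq (ghor_tangent Hv gx) oUA (conj Uv Av) _ d1 d2) => z [Uz _] Hz.
  exact: (derive2_submersion e Hz (tangent_ghor Hz (HY _ Uz Hz))).
have DSY : 'D_x (S \o Y) v = 'D_x Y v *m T.
  by rewrite (derive_comp x dY (dS _)) derive_mulmxr.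
have SYv : (S \o Y) v = y *m T by rewrite /= Yv.
rewrite (derive_id v x) Yv in D1.
rewrite DSY SYv (derive_mulmxr T v x : 'D_x S v = _) in D2.
(* The tangent part of D_x Y is transported by [derive2_submersion]; the normal part [w] is
   vertical, so [T] kills it and only D_w D_e F remains as a correction. *)
have DY := derive_dirD ('D_x Y v - w) w (dDF e Av).
rewrite subrK (derive2_submersion e Hv (tangent_ghor Hv tw)) mulmxBl wT subr0 in DY.
have {}E := etrans (esym D1) (etrans E D2).
rewrite DY in E.
rewrite !cartan_tensorE fundamental_tensorE.
exact: quarter_split E.
Qed.

End Submersion.

End LinearSubmersion.

(** * From manifolds to tangent spaces *)

Section Homogeneity.
Context {R : realType} {m : nat}.
Variables (A : set 'rV[R]_m) (F : 'rV[R]_m -> R).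
Hypotheses (oA : open A) (sF : smooth_on A F).
Hypothesis coneA : forall u (l : R), 0 < l -> A u -> A (l *: u).
Hypothesis homogF : forall u (l : R), 0 < l -> A u -> F (l *: u) = l ^+ 2 * F u.

(** Differentiating F(l z) = l^2 F(z) gives l D_w F(l u) = l^2 D_w F(u), and one factor [l]
    cancels. *)
Lemma derive_homogeneous u w (l : R) : 0 < l -> A u ->
  'D_w F (l *: u) = l * 'D_w F u.
Proof.
move=> l0 Au; pose S : {linear 'rV[R]_m -> 'rV[R]_m} := *:%R l.
have dS : differentiable S u by exact: linear_row_differentiable.
have dF z : A z -> differentiable F z by exact: smooth_on_differentiable.
have E : 'D_w (F \o S) u = 'D_w (l ^+ 2 *: F) u.
  apply: near_eq_derive.
  have : \forall z \near u, A z by exact: open_nbhs_nbhs.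
  by apply: filterS => z Az; exact: homogF.
have DS : 'D_w S u = l *: w.
  exact: (derive_lin u w (linear_row_continuous (l := S))).
have dFl := dF _ (coneA l0 Au).
rewrite (derive_comp w dS dFl) DS (deriveZ _ (diff_derivable (v := w) (dF _ Au))) in E.
rewrite (deriveE _ dFl) linearZ -(deriveE _ dFl) in E.
by apply: (mulfI (lt0r_neq0 l0)); rewrite mulrA -expr2; exact: E.
Qed.

Lemma derive_euler u w : A u -> 'D_u ('D_w F) u = 'D_w F u.
Proof.
move=> Au.
have dDF : differentiable ('D_w F) (u + 0 *: u).
  rewrite scale0r addr0.
  exact: (smooth_on_differentiable (smooth_on_derive _ sF) Au).
have [_] := is_derive_line dDF; rewrite scale0r addr0 => <-.
pose r : R := 'D_w F u.
have -> : 'D_1 (fun t : R => 'D_w F (u + t *: u)) 0 = 'D_1 (fun t : R => r + t *: r) 0.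
  apply: near_eq_derive.
  (* The bound keeps the factor 1 + t positive, as homogeneity requires. *)
  have : \forall t \near (0 : R), `|t| < 1 by exact: nbhs0_lt.
  apply: filterS => t; rewrite ltr_norml => /andP[t1 _].
  rewrite -{1}(scale1r u) -scalerDl derive_homogeneous ?mulrDl ?mul1r //.
  by rewrite -ltrBlDl sub0r.
by rewrite -derive1E (derive1_line (V := R) id) derive_id.
Qed.

End Homogeneity.

(** * The metric on a single tangent space *)

Section PointwiseFinsler.
Context {R : realType} {m : nat}.
Variables (M : manifold R m) (L : pseudo_finsler M) (p : M).

Lemma mchart_atP (q : M) : matlas (mchart_at q) /\ cdom (mchart_at q) q.
Proof. by case: M q. Qed.

Lemma chartP (c : chart R m M) : matlas c ->
  [/\ open (cdom c), open (cimg c),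
      forall p, cdom c p -> cinv c (cmap c p) = p,
      {within cdom c, continuous (cmap c)} &
      {within cimg c, continuous (cinv c)}].
Proof. by case: M c. Qed.

Lemma tangent_chart_open (c : chart R m M) : matlas c ->
  open [set z | cimg c z.1 /\ admissible L (cinv c z.1) (tvec c z)].
Proof. by case: L => A F ? ? h *; exact: (h). Qed.

Lemma tangent_chart_smooth (c : chart R m M) : matlas c ->
  smooth_on [set z | cimg c z.1 /\ admissible L (cinv c z.1) (tvec c z)]
            (fun z => L (cinv c z.1) (tvec c z)).
Proof. by case: L => A F ? ? ? h *; exact: (h). Qed.

Let c := mchart_at p.
Let q := cmap c p.

Let cimgq : cimg c q.
Proof. by exists p => //; have [] := mchart_atP p. Qed.

Lemma cinv_mchart : cinv c q = p.
Proof.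
have [/chartP[_ _ + _ _]] := mchart_atP p; exact.
Qed.

(** In the preferred chart at [p] the transition map is the identity near [q]. *)
Lemma tvec_mchart w : tvec c (q, w) = w.
Proof.
rewrite /tvec /= cinv_mchart.
have [ac _] := mchart_atP p; have [_ oi ci _ _] := chartP ac.
have -> : 'D_w (cmap (mchart_at p) \o cinv c) q = 'D_w id q.
  apply: near_eq_derive.
  have : \forall z \near q, cimg c z by exact: open_nbhs_nbhs.
  by apply: filterS => z [p' cp' <-] /=; rewrite ci.
exact: derive_id.
Qed.

Let O := [set z : 'rV[R]_m * 'rV[R]_m |
  cimg c z.1 /\ admissible L (cinv c z.1) (tvec c z)].

(** The tangent space at [p] is a slice of the tangent bundle chart, from which openness and
    smoothness are inherited. *)
Let admissibleE : admissible L p = [set w | O (q, w)].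
Proof.
apply/seteqP; split=> w; rewrite /O /= cinv_mchart tvec_mchart //.
by case.
Qed.

Lemma admissible_open : open (admissible L p).
Proof.
rewrite admissibleE; apply: open_slice.
exact: (tangent_chart_open (mchart_atP p).1).
Qed.

Lemma finsler_smooth : smooth_on (admissible L p) (L p).
Proof.
have sO : smooth_on O (fun z => L (cinv c z.1) (tvec c z)).
  exact: (tangent_chart_smooth (mchart_atP p).1).
move=> k; rewrite admissibleE.
have -> : L p = (fun w => L (cinv c (q, w).1) (tvec c (q, w))).
  by apply/funext => w; rewrite /= cinv_mchart tvec_mchart.
exact: (Ck_on_slice q (sO k)).
Qed.

Lemma admissible_cone u (l : R) : 0 < l -> admissible L p u -> admissible L p (l *: u).
Proof. by case: L => A F ? h *; exact: (h). Qed.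

Lemma finsler_homogeneous u (l : R) : 0 < l -> admissible L p u ->
  L p (l *: u) = l ^+ 2 * L p u.
Proof. by case: L => A F ? ? ? ? h *; exact: (h). Qed.

Lemma finsler_nondegenerate u : admissible L p u ->
  nondegenerate_on (fundamental_tensor (L p) u) setT.
Proof. by case: L => A F ? ? ? ? ? h; exact: (h). Qed.

End PointwiseFinsler.

(** * The differential as a matrix, and the global statement *)

Lemma differential_matrix (R : realType) m n (M : manifold R m) (B : manifold R n)
    (s : M -> B) (p : M) : smooth_map s ->
  exists T : 'M[R]_(m, n), forall v, differential s p v = v *m T.
Proof.
move=> [_ ss]; have [ac cp] := mchart_atP p; have [ad dp] := mchart_atP (s p).
have := ss _ _ ac ad => /(smooth_on_differentiable) df.
exists (jacobi (cmap (mchart_at (s p)) \o s \o cinv (mchart_at p)) (cmap (mchart_at p) p)).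
move=> v; apply: derive_jacobi => j.
apply: (differentiable_comp (g := fun z : 'rV[R]_n => z 0 j : R)).
  by apply: df; exists p.
exact: differentiable_coord.
Qed.

Theorem corollary1 (R : realType) (m n : nat)
    (M : manifold R m) (B : manifold R n)
    (L : pseudo_finsler M) (Lt : pseudo_finsler B) (sigma : M -> B)
    (hsub : pseudo_finsler_submersion L Lt sigma)
    (hnd : forall (p : M) (v : 'rV[R]_m), horizontal L sigma p v ->
       nondegenerate_on (fundamental_tensor (L p) v) (vertical sigma p))
    (p : M) (v x y e : 'rV[R]_m)
    (hv : horizontal L sigma p v)
    (hx : g_horizontal L sigma p v x)
    (hy : g_horizontal L sigma p v y) :
  let ds := differential sigma p in
  let g := fundamental_tensor (L p) v in
  cartan_tensor (L p) v x y e =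
    cartan_tensor (Lt (sigma p)) (ds v) (ds x) (ds y) (ds e)
    - 2^-1 * g (second_fundamental_form (horizontal L sigma p) g v x y) e.
Proof.
have [ssigma _ _ _ hor_sub] := hsub.
have [T dT] := differential_matrix p ssigma.
move=> ds g; rewrite /ds !dT.
have [k [K [Kfree KP]]] := kernel_basis T.
have oA := @admissible_open _ _ _ L p; have sF := @finsler_smooth _ _ _ L p.
have half (r : R) : 2^-1 * r = 0 <-> r = 0.
  by split=> [/eqP|->]; [rewrite mulf_eq0 invr_eq0 pnatr_eq0 /= => /eqP|rewrite mulr0].
have ghorE u z : g_horizontal L sigma p u z <-> ghor (L p) T u z.
  split=> h w; first by rewrite -dT => /h; rewrite fundamental_tensorE => /half.
  by rewrite /vertical /= dT => /h; rewrite fundamental_tensorE => ->; rewrite mulr0.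
have euler u w : admissible L p u -> 'D_u ('D_w (L p)) u = 'D_w (L p) u.
  by move=> Au; apply: (derive_euler oA sF _ _ w Au) => z l l0 Az;
    [exact: admissible_cone|exact: finsler_homogeneous].
(* By the Euler identity g_u(u, w) is half of D_w L(u), so horizontality becomes a first-order
   condition. *)
have HE u : horizontal L sigma p u <-> admissible L p u /\
    forall w : 'rV[R]_m, w *m T = 0 -> 'D_w (L p) u = 0.
  split=> -[Au h]; split; try exact: Au.
    by move=> w wT; rewrite -(euler _ w Au); exact: ((ghorE u u).1 h).
  by apply/ghorE => w wT; rewrite (euler _ w Au); exact: h.
have nondeg u : admissible L p u -> forall z, (forall h, 'D_z ('D_h (L p)) u = 0) -> z = 0.
  move=> Au z hz; apply: (finsler_nondegenerate Au) => // h _.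
  by rewrite fundamental_tensorE hz mulr0.
have nondegV u : horizontal L sigma p u -> forall z : 'rV[R]_m, z *m T = 0 ->
    (forall h : 'rV[R]_m, h *m T = 0 -> 'D_z ('D_h (L p)) u = 0) -> z = 0.
  move=> Hu z zT hz; apply: (hnd _ _ Hu); first by rewrite /vertical /= dT.
  by move=> h; rewrite /vertical /= dT fundamental_tensorE => /hz ->; rewrite mulr0.
have gx := (ghorE v x).1 hx; have gy := (ghorE v y).1 hy.
have HB u : horizontal L sigma p u ->
    admissible Lt (sigma p) (u *m T) /\ L p u = Lt (sigma p) (u *m T).
  by move=> /hor_sub; rewrite dT.
have II : is_second_fundamental_form (horizontal L sigma p) g v x y
    (second_fundamental_form (horizontal L sigma p) g v x y).
  (* Existence of a normal component excludes the default value 0 of [xget]. *)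
  apply: xgetPex.
  exact: (second_fundamental_form_exists oA sF HE nondegV Kfree KP x hv gy).
exact: (cartan_tensor_submersion oA sF HE nondeg nondegV Kfree KP
  (@admissible_open _ _ _ Lt (sigma p)) (@finsler_smooth _ _ _ Lt (sigma p)) HB e hv gx gy II).
Qed.
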